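(* Let $v\in S_n$ be vexillary. The map $\gamma:\mathsf{FSYT}(v)\to\mathsf{Pipes}(v)$, which sends $T\in\mathsf{FSYT}(v)$ to the unique $\mathcal P\in\mathsf{Pipes}(v)$ with $$D(\mathcal P)=\{(T(i,j),\,T(i,j)-i+j):(i,j)\in\mathbb Y(\mu^{(v)})\},$$ is a bijection (in particular, such a unique $\mathcal P$ exists for each $T$).
   Context: A permutation $v\in S_n$ is vexillary if there are no $i_1<i_2<i_3<i_4$ with $v_{i_2}<v_{i_1}<v_{i_4}<v_{i_3}$ (it avoids $2143$). Bumpless pipe dreams. Cells $(i,j)$ of the $n\times n$ grid: row $i$ from the top, column $j$ from the left. There are six tiles: downward elbow (a pipe joining the bottom and right edges), upward elbow (a pipe joining the left and top edges), crossing (one pipe joining left and right edges and one joining bottom and top edges), blank (no pipe), horizontal (left to right), vertical (bottom to top). A bumpless pipe dream (BPD) of size $n$ is a tiling of the grid by these tiles such that an edge shared by two cells is met by a pipe from both sides or from neither, every bottom and right boundary edge is met by a pipe, and no left or top boundary edge is met by a pipe. $D(\mathcal P)$ is the set of positions of blank tiles. Demazure product $\partial(\mathcal P)\in S_n$: label the bottom boundary edges $1,\dots,n$ from left to right and propagate labels along pipes north and east; at a crossing tile, of the two labels entering from the left and from below, the smaller leaves through the right edge and the larger through the top edge. $\partial(\mathcal P)(i)$ is the label arriving at the right boundary edge of row $i$. $\mathsf{Pipes}(v)=\{\mathcal P:\partial(\mathcal P)=v\}$. For a partition $\lambda$, $\mathbb Y(\lambda)=\{(i,j):1\le j\le\lambda_i\}$.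 The Rothe diagram is $D(v)=\{(i,j):v_i>j,\ v^{-1}(j)>i\}$ and the Lehmer code is $\mathsf c_v(i)=|\{j:(i,j)\in D(v)\}|$. $\mu^{(v)}$ is the partition obtained by sorting the entries of $\mathsf c_v$ into weakly decreasing order; $\lambda^{(v)}$ is the partition with $\mathbb Y(\lambda^{(v)})=\bigcup_{(i,j)\in D(v)}[1,i]\times[1,j]$. The flag $\mathbf f^{(v)}$: $f^{(v)}_i$ is the maximal row index $j$ with $(j,\,j-i+\mu^{(v)}_i)\in\mathbb Y(\lambda^{(v)})$. $\mathsf{FSYT}(v)$ is the set of semistandard tableaux $T:\mathbb Y(\mu^{(v)})\to\{1,2,\dots\}$ (weakly increasing along rows left to right, strictly increasing down columns) that are flagged by $\mathbf f^{(v)}$, i.e. $T(i,j)\le f^{(v)}_i$ for all $(i,j)\in\mathbb Y(\mu^{(v)})$. *)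

(* Defs.v *)
Set Warnings "-notation-overridden,-ambiguous-paths".
From HB Require Import structures.
From mathcomp Require Import all_boot all_fingroup all_algebra.

Set Implicit Arguments.
Unset Strict Implicit.
Unset Printing Implicit Defensive.

(** Conventions. Grid cells are pairs of ordinals in ['I_n], hence 0-based;
    cells of Young diagrams and entries of tableaux are 1-based naturals.
    [coords] passes from the former numbering to the latter. Permutations
    [v : 'S_n] act on [{0, ..., n-1}]. *)

Definition coords n (A : {set 'I_n * 'I_n}) : seq (nat * nat) :=
  [seq (c.1.+1, c.2.+1) | c : 'I_n * 'I_n in A].

Definition vexillary n (v : 'S_n) : Prop :=
  forall i1 i2 i3 i4 : 'I_n, i1 < i2 -> i2 < i3 -> i3 < i4 ->
    ~ [/\ v i2 < v i1, v i1 < v i4 & v i4 < v i3].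

(** * Bumpless pipe dreams *)

Inductive tile :=
  DownElbow | UpElbow | Crossing | Blank | Horizontal | Vertical.

Definition nat_of_tile (t : tile) : nat :=
  match t with
  | DownElbow => 0 | UpElbow => 1 | Crossing => 2
  | Blank => 3 | Horizontal => 4 | Vertical => 5
  end.

Definition tile_of_nat (k : nat) : tile :=
  nth Blank [:: DownElbow; UpElbow; Crossing; Blank; Horizontal; Vertical] k.

Lemma nat_of_tileK : cancel nat_of_tile tile_of_nat.
Proof. by case. Qed.

HB.instance Definition _ := Countable.copy tile (can_type nat_of_tileK).

Lemma tile_enumP :
  Finite.axiom [:: DownElbow; UpElbow; Crossing; Blank; Horizontal; Vertical].
Proof. by case. Qed.

HB.instance Definition _ := isFinite.Build tile tile_enumP.

Definition meets_left (t : tile) : bool :=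
  match t with UpElbow | Crossing | Horizontal => true | _ => false end.
Definition meets_right (t : tile) : bool :=
  match t with DownElbow | Crossing | Horizontal => true | _ => false end.
Definition meets_top (t : tile) : bool :=
  match t with UpElbow | Crossing | Vertical => true | _ => false end.
Definition meets_bottom (t : tile) : bool :=
  match t with DownElbow | Crossing | Vertical => true | _ => false end.

Definition is_bpd n (P : 'M[tile]_n) : bool :=
  [&& [forall i : 'I_n, forall j : 'I_n, forall k : 'I_n,
         (k == j.+1 :> nat) ==> (meets_right (P i j) == meets_left (P i k))],
      [forall i : 'I_n, forall k : 'I_n, forall j : 'I_n,
         (k == i.+1 :> nat) ==> (meets_bottom (P i j) == meets_top (P k j))],
      [forall i : 'I_n, forall j : 'I_n,
         (i.+1 == n) ==> meets_bottom (P i j)],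
      [forall i : 'I_n, forall j : 'I_n,
         (j.+1 == n) ==> meets_right (P i j)],
      [forall i : 'I_n, forall j : 'I_n,
         (j == 0 :> nat) ==> ~~ meets_left (P i j)]
    & [forall i : 'I_n, forall j : 'I_n,
         (i == 0 :> nat) ==> ~~ meets_top (P i j)]].

Definition blanks n (P : 'M[tile]_n) : {set 'I_n * 'I_n} :=
  [set c | P c.1 c.2 == Blank].

(** Labels are the numbers [1, ..., n]; 0 stands for the absence of a label
    on an edge that no pipe meets. [propagate t l b] is the pair of labels
    leaving [t] through its right and top edges when [l] enters from the left
    and [b] from below. *)
Definition propagate (t : tile) (l b : nat) : nat * nat :=
  match t with
  | DownElbow => (b, 0)
  | UpElbow => (0, l)
  | Crossing => (minn l b, maxn l b)
  | Blank => (0, 0)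
  | Horizontal => (l, 0)
  | Vertical => (0, b)
  end.

Definition tile_at n (P : 'M[tile]_n) (i j : nat) : tile :=
  match (insub i : option 'I_n), (insub j : option 'I_n) with
  | Some i', Some j' => P i' j'
  | _, _ => Blank
  end.

(** In a row with tiles [t 0, t 1, ...] and labels [b 0, b 1, ...] on its
    bottom edges, the label on the vertical edge to the left of column [j]. *)
Fixpoint row_label (t : nat -> tile) (b : nat -> nat) (j : nat) : nat :=
  if j is j'.+1 then (propagate (t j') (row_label t b j') (b j')).1 else 0.

(** The labels on the horizontal line lying [k] rows above the bottom
    boundary. *)
Fixpoint line_label n (P : 'M[tile]_n) (k : nat) : nat -> nat :=
  if k is k'.+1 then
    let t := tile_at P (n - k) in
    let b := line_label P k' in
    fun j => (propagate (t j) (row_label t b j) (b j)).2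
  else fun j => j.+1.

Definition demazure n (P : 'M[tile]_n) (i : 'I_n) : nat :=
  row_label (tile_at P i) (line_label P (n - i.+1)) n.

Definition Pipes n (v : 'S_n) : Type :=
  {P : 'M[tile]_n | is_bpd P && [forall i, demazure P i == (v i).+1]}.

(** * Partitions and the shapes attached to a permutation *)

(** A partition is a weakly decreasing sequence, possibly with trailing zeros;
    [part la i] is its [i]-th part, for [i >= 1]. *)
Definition part (la : seq nat) (i : nat) : nat := nth 0 la i.-1.

Definition young (la : seq nat) : seq (nat * nat) :=
  [seq (i, j) | i <- iota 1 (size la), j <- iota 1 (part la i)].

Lemma mem_young la i j :
  ((i, j) \in young la) = (0 < i) && (0 < j <= part la i).
Proof.
apply/allpairsPdep/idP => [[a [b [+ + [-> ->]]]]|/and3P[i0 j0 jle]].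
  by rewrite !mem_iota !add1n !ltnS => /andP[-> _] /andP[-> ->].
exists i, j; split=> //; rewrite mem_iota add1n ltnS ?j0 // i0 /=.
rewrite leqNgt; apply/negP => si; move: jle.
rewrite /part nth_default; first by rewrite leqNgt j0.
by case: i i0 si.
Qed.

Definition rothe n (v : 'S_n) : {set 'I_n * 'I_n} :=
  [set c : 'I_n * 'I_n | (c.2 < v c.1) && (c.1 < (v^-1)%g c.2)].

Definition code n (v : 'S_n) (i : 'I_n) : nat :=
  #|[set j | (i, j) \in rothe v]|.

Definition mu n (v : 'S_n) : seq nat :=
  sort geq [seq code v i | i <- enum 'I_n].

Definition lambda n (v : 'S_n) : seq nat :=
  mkseq
    (fun i => \max_(c : 'I_n * 'I_n | (c \in rothe v) && (i <= c.1)) c.2.+1) n.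

Lemma lambda_sorted n (v : 'S_n) : sorted geq (lambda v).
Proof.
apply/(sortedP 0) => i; rewrite size_mkseq => ltin.
rewrite !nth_mkseq ?(ltnW ltin) //=; apply/bigmax_leqP => c /andP[cv lic].
by apply: (@leq_bigmax_cond _ _ (fun c : 'I_n * 'I_n => c.2.+1)); rewrite cv ltnW.
Qed.

(** [young (lambda v)] is the union of the rectangles [[1, i] x [1, j]] over
    the cells [(i, j)] of the Rothe diagram. *)
Lemma young_lambda n (v : 'S_n) a b :
  reflect (exists2 c, c \in coords (rothe v) & 0 < a <= c.1 /\ 0 < b <= c.2)
          ((a, b) \in young (lambda v)).
Proof.
rewrite mem_young; case: a => [|a] /=; first by right; case=> ? _ [].
case: b => [|b] /=; first by right; case=> ? _ [].
rewrite /part /=; apply: (iffP idP) => [|[_ /imageP[c cv ->] [/= ac bc]]].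
  have [lt|ge] := ltnP a n; last by rewrite nth_default // size_mkseq.
  rewrite nth_mkseq // => bm.
  pose P (c : 'I_n * 'I_n) := (c \in rothe v) && (a <= c.1).
  have [c /andP[cv ac] bc] : exists2 c, P c & b < c.2.+1.
    apply/exists_inP; apply: contraLR bm => /exists_inPn h.
    by rewrite -leqNgt; apply/bigmax_leqP => c Pc; rewrite leqNgt h.
  by exists (c.1.+1, c.2.+1) => //; apply: image_f.
have ltan : a < n by apply: leq_ltn_trans (ltn_ord c.1).
rewrite nth_mkseq //; apply: leq_trans bc _.
by apply: (@leq_bigmax_cond _ _ (fun c : 'I_n * 'I_n => c.2.+1)); rewrite cv.
Qed.

(** [j + part (mu v) i - i] is truncated at 0, which is never the column of a
    cell. *)
Definition flag n (v : 'S_n) (i : nat) : nat :=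
  \max_(1 <= j < n.+1 | (j, j + part (mu v) i - i) \in young (lambda v)) j.

(** * Flagged tableaux *)

Definition tableau (la : seq nat) : Type := {ffun seq_sub (young la) -> nat}.

Definition semistandard la (T : tableau la) : bool :=
  [&& [forall c, 0 < T c],
      [forall c, forall d,
         ((val c).1 == (val d).1) && ((val c).2 <= (val d).2)
           ==> (T c <= T d)]
    & [forall c, forall d,
         ((val c).2 == (val d).2) && ((val c).1 < (val d).1)
           ==> (T c < T d)]].

Definition FSYT n (v : 'S_n) : Type :=
  {T : tableau (mu v) |
    semistandard T && [forall c, T c <= flag v (val c).1]}.

(** The subtraction is not truncated on a semistandard tableau, where
    [i <= T (i, j)]. *)
Definition positions la (T : tableau la) : seq (nat * nat) :=
  [seq (T c, T c + (val c).2 - (val c).1) | c : seq_sub (young la)].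

(* Main.v *)
Require Import Defs.
From mathcomp Require Import all_boot all_fingroup all_algebra.
From mathcomp Require Import zify.

(** For vexillary [v], no two pipes of a bumpless pipe dream in [Pipes v] cross
    inside the shape [lambda v], and outside of it all of [Pipes v] agrees with
    the Rothe bumpless pipe dream. Encode a bumpless pipe dream by the number
    [rank P i j] of pipes crossing the first [j] edges of the line above row
    [i]. Along a diagonal inside [lambda v] the rank is constant at a blank and
    grows by one elsewhere, so it records the rows of the blanks; the values at
    the border of [lambda v] fix the number of blanks on each diagonal, which
    is the number of cells of [mu v] there. Listing the blanks of each
    diagonal from top to bottom gives a filling of [mu v]. That horizontal and
    vertical steps change the rank by at most one says that the filling is
    semistandard, and that the blanks stay inside [lambda v] says that it is
    flagged. *)

Set Implicit Arguments.
Unset Strict Implicit.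
Unset Printing Implicit Defensive.

(** * Rank function and outer cells of a permutation *)

(** Blanks only see ranks, whereas the Demazure product is defined by labels, and ranks forget
    labels: two pipes may cross several times, each crossing sorting their labels anew. The
    translation is needed both ways. [rank_outer] and [inner_no_crossing] extract rank conditions
    from the labels; [demazure_rank] recovers the labels, so that an array of ranks built from a
    tableau does give an element of [Pipes v]. Every use of vexillarity goes through
    [inner_increasing]. A second obstacle is that [mu v] is a sorted code, in which no diagonal is
    visible; [young_mu_rothe] ties it to the diagonals of the Rothe diagram. Bijectivity comes from
    existence in both directions, together with the fact that a pipe dream is determined by its
    blanks and a tableau by its positions. *)

Definition permn n (s : 'S_n) (i : nat) : nat :=
  if insub i is Some a then s a else 0.

Lemma permnE n (s : 'S_n) (a : 'I_n) : permn s a = s a.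
Proof. by rewrite /permn valK. Qed.

Lemma permn_lt n (s : 'S_n) i : i < n -> permn s i < n.
Proof. by move=> lt_in; rewrite (permnE s (Ordinal lt_in)). Qed.

Lemma permnK n (s : 'S_n) i : i < n -> permn s^-1 (permn s i) = i.
Proof.
by move=> lt_in; rewrite (permnE s (Ordinal lt_in)) (permnE (s^-1)%g) permK.
Qed.

Lemma permnKV n (s : 'S_n) i : i < n -> permn s (permn s^-1 i) = i.
Proof. by move=> lt_in; rewrite -{1}(invgK s) permnK. Qed.

Lemma permn_eq n (s : 'S_n) i j :
  i < n -> j < n -> (permn s i == j) = (permn s^-1 j == i).
Proof.
move=> lt_in lt_jn; apply/eqP/eqP => <-; first exact: permnK.
exact: permnKV.
Qed.

Section Permutation.

Variables (n : nat) (v : 'S_n).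

Local Notation w := (permn v).
Local Notation wi := (permn (v^-1)%g).

(** This is the rank function of the Rothe bumpless pipe dream, where a pipe meets the line above
    row [i] in column [b] exactly when [wi b < i]. *)
Definition prank (i j : nat) : nat := \sum_(a < i) (w a < j).

Lemma prankS i j : prank i.+1 j = prank i j + (w i < j).
Proof. by rewrite /prank big_ord_recr. Qed.

Lemma prank0 j : prank 0 j = 0.
Proof. by rewrite /prank big_ord0. Qed.

Lemma prank_0 i : prank i 0 = 0.
Proof. by rewrite /prank big1. Qed.

Lemma prank_S i j : i <= n -> j < n -> prank i j.+1 = prank i j + (wi j < i).
Proof.
move=> + lt_jn; elim: i => [|i IHi] lt_in; first by rewrite !prank0.
rewrite !prankS IHi ?(ltnW lt_in) //.
have := permn_eq v lt_in lt_jn; lia.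
Qed.

Lemma prank_n i : i <= n -> prank i n = i.
Proof.
by elim: i => [|i IHi] le_in; rewrite ?prank0 // prankS IHi ?permn_lt //; lia.
Qed.

Lemma prankn j : j <= n -> prank n j = j.
Proof.
elim: j => [|j IHj] le_jn; first by rewrite prank_0.
by rewrite prank_S // IHj ?permn_lt //; lia.
Qed.

(** The cell [(i, j)] lies outside of the shape [lambda v]; equivalently, no
    cell of the Rothe diagram lies weakly south-east of it. *)
Definition outer (i j : nat) : bool :=
  [forall c : 'I_n * 'I_n, (c \in rothe v) ==> ~~ ((i <= c.1) && (j <= c.2))].

Lemma rotheE (i j : 'I_n) : ((i, j) \in rothe v) = (j < w i) && (i < wi j).
Proof. by rewrite inE /= !permnE. Qed.

Lemma outerP i j :
  reflect (forall a b, a < n -> b < n -> i <= a -> j <= b ->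
             ~~ ((b < w a) && (a < wi b)))
          (outer i j).
Proof.
apply: (iffP forallP) => [h a b lt_an lt_bn le_ia le_jb|h [a b]].
  apply/negP; rewrite -(rotheE (Ordinal lt_an) (Ordinal lt_bn)) => hc.
  by move: (h (Ordinal lt_an, Ordinal lt_bn)); rewrite hc /= le_ia le_jb.
apply/implyP; rewrite rotheE => hc.
apply/negP => /andP[/= h1 h2].
by move: (h _ _ (ltn_ord a) (ltn_ord b) h1 h2); rewrite hc.
Qed.

Lemma innerP i j :
  reflect (exists a b,
             [/\ a < n, b < n, i <= a, j <= b & (b < w a) && (a < wi b)])
          (~~ outer i j).
Proof.
apply: (iffP forallPn) => [[[a b]]|[a [b [lt_an lt_bn le_ia le_jb h]]]].
  by rewrite negb_imply negbK rotheE /= => /and3P[h1 h2 h3]; exists a, b.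
exists (Ordinal lt_an, Ordinal lt_bn).
by rewrite negb_imply negbK rotheE /= h le_ia le_jb.
Qed.

Lemma outer_mono i j a b : i <= a -> j <= b -> outer i j -> outer a b.
Proof.
move=> le_ia le_jb /outerP h; apply/outerP => a' b' *.
by apply: h => //; lia.
Qed.

Lemma inner_lt i j : ~~ outer i j -> i < n /\ j < n.
Proof. by case/innerP => a [b [*]]; split; lia. Qed.

Lemma mem_young_lambda a b :
  ((a, b) \in young (lambda v)) = [&& 0 < a, 0 < b & ~~ outer a.-1 b.-1].
Proof.
apply/young_lambda/and3P.
  case=> _ /imageP[[i j] hij ->] [/= /andP[a0 ai] /andP[b0 bj]].
  split=> //; apply/innerP; exists i, j; rewrite -rotheE.
  by split=> //; lia.
case=> a0 b0 /innerP[i [j [lt_in lt_jn hi hj hij]]].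
exists (i.+1, j.+1); last by rewrite /=; split; lia.
apply/imageP; exists (Ordinal lt_in, Ordinal lt_jn) => //.
by rewrite rotheE.
Qed.

Hypothesis vex : vexillary v.

Lemma vexillary_nat i1 i2 i3 i4 : i1 < i2 -> i2 < i3 -> i3 < i4 -> i4 < n ->
  ~ [/\ w i2 < w i1, w i1 < w i4 & w i4 < w i3].
Proof.
move=> h1 h2 h3 h4.
have l3 := ltn_trans h3 h4; have l2 := ltn_trans h2 l3.
have l1 := ltn_trans h1 l2.
have := @vex (Ordinal l1) (Ordinal l2) (Ordinal l3) (Ordinal h4) h1 h2 h3.
by rewrite -!permnE.
Qed.

(** An inversion weakly north-west of a cell of the shape [lambda v] would be
    completed to the pattern [2143] by a cell of the Rothe diagram. *)
Lemma inner_increasing i j a b :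
  ~~ outer i j -> a < b -> b <= i -> w a <= j -> w a <= w b.
Proof.
move=> hout lt_ab le_bi le_wj; rewrite leqNgt; apply/negP => lt_w.
case/innerP: hout => i' [j' [li lj hi hj /andP[h1 h2]]].
have lwi : wi j' < n by exact: permn_lt.
have wiK : w (wi j') = j' by exact: permnKV.
have nb : b != i' by apply/eqP => e; subst b; lia.
have na : w a != j'.
  by apply/eqP => e; move: h2; rewrite -e permnK; lia.
(* The pattern 2143 sits in rows [a], [b], [i'], [wi j'], with values [w a], [w b], [w i'], [j']. *)
apply: (@vexillary_nat a b i' (wi j')); try lia.
rewrite wiK; split=> //; lia.
Qed.

(** No crossing inside [lambda v] in the Rothe bumpless pipe dream. *)
Lemma prank_inner i j : ~~ outer i j -> prank i.+1 j.+1 <= (prank i j).+1.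
Proof.
move=> hout; have [lt_in lt_jn] := inner_lt hout.
rewrite prankS prank_S ?(ltnW lt_in) //.
case: (ltnP (wi j) i) => [h|]; last by lia.
have wiK : w (wi j) = j by exact: permnKV.
have := inner_increasing hout h (leqnn i); rewrite wiK => /(_ (leqnn j)).
rewrite leq_eqVlt => /orP[/eqP e|]; last by lia.
by move: h; rewrite e permnK //; lia.
Qed.

End Permutation.

(** * Edges, labels and ranks of a bumpless pipe dream *)

Lemma tile_ext (s t : tile) :
  meets_left s = meets_left t -> meets_top s = meets_top t ->
  meets_right s = meets_right t -> meets_bottom s = meets_bottom t -> s = t.
Proof. by case: s; case: t. Qed.

(** Pipes enter a tile from below and from the left, and leave it upwards and to the right. Summed
    along a row, this makes horizontal edges the row increments of the rank ([rankS]). *)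
Lemma tile_conserve t :
  meets_bottom t + meets_left t = meets_top t + meets_right t.
Proof. by case: t. Qed.

Definition tile_of_edges (l t r b : bool) : tile :=
  if l then if b then Crossing else if t then UpElbow else Horizontal
  else if b then if t then Vertical else DownElbow else Blank.

Lemma tile_of_edgesP (l t r b : bool) : b + l = t + r ->
  let s := tile_of_edges l t r b in
  [/\ meets_left s = l, meets_top s = t, meets_right s = r & meets_bottom s = b].
Proof. by case: l; case: t; case: r; case: b. Qed.

Lemma tile_atE n (P : 'M[tile]_n) (i j : 'I_n) : tile_at P i j = P i j.
Proof. by rewrite /tile_at !valK. Qed.

(** Whether a pipe meets the edge at the bottom of row [i.-1], column [j]. *)
Definition vedge n (P : 'M[tile]_n) (i j : nat) : bool :=
  (0 < i) && meets_bottom (tile_at P i.-1 j).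

(** Whether a pipe meets the edge at the right of row [i], column [j.-1]. *)
Definition hedge n (P : 'M[tile]_n) (i j : nat) : bool :=
  (0 < j) && meets_right (tile_at P i j.-1).

(** Since [vedge] and [hedge] are false at index 0, the first two clauses also contain the top and
    left boundary conditions. *)
Definition edges_ok n (P : 'M[tile]_n) : Prop :=
  [/\ forall i j, i < n -> j < n -> meets_left (tile_at P i j) = hedge P i j,
      forall i j, i < n -> j < n -> meets_top (tile_at P i j) = vedge P i j,
      forall j, j < n -> vedge P n j
    & forall i, i < n -> hedge P i n].

Lemma is_bpdP n (P : 'M[tile]_n) : reflect (edges_ok P) (is_bpd P).
Proof.
apply: (iffP and5P) => [[h1 h2 h3 h4 /andP[h5 h6]]|[h1 h2 h3 h4]].
  split=> [i j li lj|i j li lj|j lj|i li].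
  - rewrite /hedge; case: j lj => [|j] lj /=.
      move/forallP/(_ (Ordinal li))/forallP/(_ (Ordinal lj)): h5 => /= h.
      by apply/negbTE; rewrite -(tile_atE P (Ordinal li) (Ordinal lj)) in h.
    move/forallP/(_ (Ordinal li))/forallP/(_ (Ordinal (ltnW lj))): h1.
    move/forallP/(_ (Ordinal lj)); rewrite /= eqxx /= -!tile_atE => /eqP e.
    by rewrite e.
  - rewrite /vedge; case: i li => [|i] li /=.
      move/forallP/(_ (Ordinal li))/forallP/(_ (Ordinal lj)): h6 => /= h.
      by apply/negbTE; rewrite -(tile_atE P (Ordinal li) (Ordinal lj)) in h.
    move/forallP/(_ (Ordinal (ltnW li)))/forallP/(_ (Ordinal li)): h2.
    move/forallP/(_ (Ordinal lj)); rewrite /= eqxx /= -!tile_atE => /eqP e.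
    by rewrite e.
  - rewrite /vedge; have n0 : 0 < n by lia.
    have l1 : n.-1 < n by lia.
    rewrite n0 /=; move/forallP/(_ (Ordinal l1))/forallP/(_ (Ordinal lj)): h3.
    by rewrite -tile_atE /= prednK ?eqxx.
  - rewrite /hedge; have n0 : 0 < n by lia.
    have l1 : n.-1 < n by lia.
    rewrite n0 /=; move/forallP/(_ (Ordinal li))/forallP/(_ (Ordinal l1)): h4.
    by rewrite -tile_atE /= prednK ?eqxx.
split.
- apply/forallP => i; apply/forallP => j; apply/forallP => k.
  apply/implyP => /eqP e; rewrite -!tile_atE h1 ?ltn_ord //.
  by rewrite /hedge e.
- apply/forallP => i; apply/forallP => j; apply/forallP => k.
  apply/implyP => /eqP e; rewrite -!tile_atE h2 ?ltn_ord //.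
  by rewrite /vedge e.
- apply/forallP => i; apply/forallP => j; apply/implyP => /eqP e.
  have ei : n.-1 = i by lia.
  by move: (h3 j (ltn_ord j)); rewrite /vedge -tile_atE ei => /andP[].
- apply/forallP => i; apply/forallP => j; apply/implyP => /eqP e.
  have ej : n.-1 = j by lia.
  by move: (h4 i (ltn_ord i)); rewrite /hedge -tile_atE ej => /andP[].
apply/andP; split.
  apply/forallP => i; apply/forallP => j; apply/implyP => /eqP e.
  by rewrite -tile_atE h1 ?ltn_ord // /hedge e.
apply/forallP => i; apply/forallP => j; apply/implyP => /eqP e.
by rewrite -tile_atE h2 ?ltn_ord // /vedge e.
Qed.

(** The labels on the horizontal line between rows [i.-1] and [i]. *)
Definition vlabel n (P : 'M[tile]_n) (i : nat) : nat -> nat :=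
  line_label P (n - i).

(** The label on the edge at the left of the cell [(i, j)]. *)
Definition hlabel n (P : 'M[tile]_n) (i : nat) : nat -> nat :=
  row_label (tile_at P i) (vlabel P i.+1).

(** Counting a label on an initial part of a line replaces following its pipe; [label_count_row] is
    the conservation law on which the arguments about labels rest. *)
Definition label_count n (P : 'M[tile]_n) (i m x : nat) : nat :=
  \sum_(b < m) (vlabel P i b == x).

Definition rank n (P : 'M[tile]_n) (i j : nat) : nat := \sum_(b < j) vedge P i b.

Section BPD.

Variables (n : nat) (P : 'M[tile]_n).

Local Notation t := (tile_at P).
Local Notation L := (vlabel P).
Local Notation H := (hlabel P).
Local Notation cnt := (label_count P).

Lemma vlabelE i j : i < n -> L i j = (propagate (t i j) (H i j) (L i.+1 j)).2.
Proof.
move=> lt_in; rewrite /hlabel /vlabel.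
have -> : n - i = (n - i.+1).+1 by lia.
by rewrite /=; have -> : n - (n - i.+1).+1 = i by lia.
Qed.

Lemma hlabelS i j : H i j.+1 = (propagate (t i j) (H i j) (L i.+1 j)).1.
Proof. by []. Qed.

Lemma hlabel0 i : H i 0 = 0.
Proof. by []. Qed.

Lemma vlabel_bottom b : L n b = b.+1.
Proof. by rewrite /vlabel subnn. Qed.

Lemma demazure_hlabel (i : 'I_n) : demazure P i = H i n.
Proof. by []. Qed.

Lemma vedgeS i j : vedge P i.+1 j = meets_bottom (t i j).
Proof. by []. Qed.

Lemma hedgeS i j : hedge P i j.+1 = meets_right (t i j).
Proof. by []. Qed.

Lemma hedge0 i : hedge P i 0 = false.
Proof. by []. Qed.

Lemma vedge0 j : vedge P 0 j = false.
Proof. by []. Qed.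

Lemma label_countS i m x : cnt i m.+1 x = cnt i m x + (L i m == x).
Proof. by rewrite /label_count big_ord_recr. Qed.

Lemma label_count0 i x : cnt i 0 x = 0.
Proof. by rewrite /label_count big_ord0. Qed.

Lemma rank_S i j : rank P i j.+1 = rank P i j + vedge P i j.
Proof. by rewrite /rank big_ord_recr. Qed.

Lemma rank_0 i : rank P i 0 = 0.
Proof. by rewrite /rank big_ord0. Qed.

Lemma rank_le_S i j m : j <= m -> rank P i j <= rank P i m.
Proof.
move=> le_jm; rewrite -(subnK le_jm); elim: (m - j) => // d IHd.
by rewrite addSn rank_S; lia.
Qed.

Lemma rank0 j : rank P 0 j = 0.
Proof. by rewrite /rank big1. Qed.

Lemma label_count_le i m p x : m <= p -> cnt i m x <= cnt i p x.
Proof.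
move=> le_mp; rewrite -(subnK le_mp); elim: (p - m) => // k.
by rewrite addSn label_countS; lia.
Qed.

Lemma label_count_gt0P i m x :
  reflect (exists2 b, b < m & L i b = x) (0 < cnt i m x).
Proof.
apply: (iffP idP) => [|[b lt_bm <-]].
  elim: m => [|m IHm]; first by rewrite label_count0.
  rewrite label_countS; case: eqP => [e _|_]; first by exists m.
  by rewrite addn0 => /IHm [b lt_bm e]; exists b => //; lia.
apply: leq_trans (label_count_le _ _ lt_bm).
by rewrite label_countS eqxx addn1.
Qed.

Lemma label_count_two i a b m x :
  a < b -> b < m -> L i a = x -> L i b = x -> 1 < cnt i m x.
Proof.
move=> lt_ab lt_bm ea eb.
apply: leq_trans (label_count_le _ _ lt_bm).
rewrite label_countS eb eqxx addn1 ltnS.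
by apply/label_count_gt0P; exists a.
Qed.

Hypothesis Pbpd : is_bpd P.

Let edgesP : edges_ok P := is_bpdP P Pbpd.

Lemma rankS i j : i < n -> j <= n -> rank P i.+1 j = rank P i j + hedge P i j.
Proof.
case: edgesP => hl ht _ _ lt_in; elim: j => [|j IHj] lt_jn.
  by rewrite !rank_0.
rewrite !rank_S IHj ?(ltnW lt_jn) //.
move: (tile_conserve (t i j)); rewrite hl // ht // vedgeS hedgeS; lia.
Qed.

Lemma rank_n i : i <= n -> rank P i n = i.
Proof.
case: edgesP => _ _ _ hr; elim: i => [|i IHi] lt_in; first by rewrite rank0.
by rewrite rankS // IHi ?hr //; lia.
Qed.

Lemma rank_le i j : i <= n -> j <= n -> rank P i j <= minn i j.
Proof.
move=> le_in le_jn; rewrite leq_min; apply/andP; split; last first.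
  by elim: j {le_jn} => [|j IHj]; rewrite ?rank_0 // rank_S; lia.
elim: i le_in => [|i IHi] lt_in; first by rewrite rank0.
by rewrite rankS //; have := IHi (ltnW lt_in); lia.
Qed.

Lemma rank_leS i k j : i <= k -> k <= n -> j <= n -> rank P i j <= rank P k j.
Proof.
move=> le_ik + le_jn; rewrite -(subnK le_ik); elim: (k - i) => // d IHd lt_n.
by rewrite addSn rankS //; have := IHd (ltnW lt_n); lia.
Qed.

Lemma label_met_aux i : i <= n ->
  (forall j, j < n -> (L i j != 0) = vedge P i j) /\
  (i < n -> forall j, j <= n -> (H i j != 0) = hedge P i j).
Proof.
case: edgesP => hl ht hb hr; move: {2}(n - i) (erefl (n - i)) => k.
elim: k i => [|k IHk] i.
  move=> e le_in; have {e le_in} -> : i = n by lia.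
  by split=> [j lt_jn|]; rewrite ?ltnn // vlabel_bottom hb.
move=> ek le_in; have lt_in : i < n by lia.
have [|//|hL _] := IHk i.+1; first by lia.
have hH j : j <= n -> (H i j != 0) = hedge P i j.
  elim: j => [|j IHj] lt_jn; first by rewrite hedge0.
  move: (IHj (ltnW lt_jn)) (hL j lt_jn); rewrite hlabelS hedgeS vedgeS -hl //.
  case: (t i j) => //=; try lia.
split=> // j lt_jn; rewrite vlabelE // -ht //.
move: (hH j (ltnW lt_jn)) (hL j lt_jn); rewrite -hl // vedgeS.
by case: (t i j) => //=; lia.
Qed.

Lemma vlabel_met i j : i <= n -> j < n -> (L i j != 0) = vedge P i j.
Proof. by move=> le_in; exact: (label_met_aux le_in).1. Qed.

Lemma hlabel_met i j : i < n -> j <= n -> (H i j != 0) = hedge P i j.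
Proof. by move=> lt_in; exact: (label_met_aux (ltnW lt_in)).2. Qed.

Variant cell_spec (l b r u : nat) : tile -> Type :=
| CellDown of l = 0 & b != 0 & r = b & u = 0 : cell_spec l b r u DownElbow
| CellUp of l != 0 & b = 0 & r = 0 & u = l : cell_spec l b r u UpElbow
| CellCross of l != 0 & b != 0 & r = minn l b & u = maxn l b :
    cell_spec l b r u Crossing
| CellBlank of l = 0 & b = 0 & r = 0 & u = 0 : cell_spec l b r u Blank
| CellHor of l != 0 & b = 0 & r = l & u = 0 : cell_spec l b r u Horizontal
| CellVert of l = 0 & b != 0 & r = 0 & u = b : cell_spec l b r u Vertical.

Lemma cellP i j : i < n -> j < n ->
  cell_spec (H i j) (L i.+1 j) (H i j.+1) (L i j) (t i j).
Proof.
case: edgesP => hl ht hb hr lt_in lt_jn; rewrite hlabelS [L i j]vlabelE //.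
move: (hlabel_met lt_in (ltnW lt_jn)) (vlabel_met lt_in lt_jn).
rewrite -hl // vedgeS.
by case: (t i j) => /= e1 e2; constructor => //; apply/eqP; lia.
Qed.

(** A label entering the first [m] columns of row [i] from below leaves them upwards or through the
    left edge of column [m]. *)
Lemma label_count_row i m x : i < n -> m <= n -> 0 < x ->
  cnt i.+1 m x = cnt i m x + (H i m == x).
Proof.
move=> lt_in + x0; elim: m => [|m IHm] lt_mn.
  by rewrite !label_count0 hlabel0; lia.
rewrite !label_countS IHm ?(ltnW lt_mn) //.
by case: (cellP lt_in lt_mn) => e1 e2 e3 e4; lia.
Qed.

Lemma label_count_bottom m x : cnt n m x = (0 < x <= m).
Proof.
elim: m => [|m IHm]; rewrite ?label_count0 ?label_countS ?IHm ?vlabel_bottom.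
  by case: x.
by lia.
Qed.

Lemma label_count_up i k m x : i <= k -> k <= n -> m <= n -> 0 < x ->
  cnt i m x <= cnt k m x.
Proof.
move=> le_ik + le_mn x0; rewrite -(subnK le_ik); elim: (k - i) => // d IHd le_kn.
apply: leq_trans (IHd _) _; first by lia.
by rewrite addSn (label_count_row (i := d + i)) //; lia.
Qed.

(** Counts do not grow upwards, and the bottom line carries [x] once, in column [x.-1]. One bound
    gives both uniqueness of labels and the absence of westward motion. *)
Lemma label_count_le1 i m x : i <= n -> m <= n -> 0 < x -> cnt i m x <= (x <= m).
Proof.
move=> le_in le_mn x0; have := label_count_up le_in (leqnn n) le_mn x0.
by rewrite label_count_bottom x0.
Qed.

Lemma vlabel_le i j : i <= n -> j < n -> L i j <= j.+1.
Proof.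
move=> le_in lt_jn; case: (posnP (L i j)) => [-> //|x0].
have := label_count_le1 le_in lt_jn x0.
by rewrite label_countS eqxx; lia.
Qed.

Lemma vlabel_inj i a b : i <= n -> a < n -> b < n -> L i a != 0 ->
  L i a = L i b -> a = b.
Proof.
move=> le_in lt_an lt_bn + e; rewrite -lt0n => x0.
have := label_count_le1 le_in (leqnn n) x0.
have two := @label_count_two i _ _ n (L i a).
have [lt|lt|//] := ltngtP a b; [have := two _ _ lt lt_bn | have := two _ _ lt lt_an];
  by rewrite -e => /(_ erefl erefl); lia.
Qed.

Lemma hlabel_count i m : i < n -> m <= n -> 0 < H i m -> 0 < cnt i.+1 m (H i m).
Proof. by move=> lt_in le_mn x0; rewrite label_count_row // eqxx addn1. Qed.

Lemma hlabel_le i m : i < n -> m <= n -> H i m <= m.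
Proof.
move=> lt_in le_mn; case: (posnP (H i m)) => [-> //|x0].
have := hlabel_count lt_in le_mn x0; have := label_count_le1 lt_in le_mn x0; lia.
Qed.

Lemma vlabel_top i b : i < n -> b < n -> 0 < L i b ->
  exists2 a, a <= b & L i.+1 a = L i b.
Proof.
move=> lt_in lt_bn x0; apply/(@label_count_gt0P i.+1 b.+1).
rewrite label_count_row // (leq_trans _ (leq_addr _ _)) //.
by apply/label_count_gt0P; exists b.
Qed.

Lemma hlabel_after_gap i a m : i < n -> a <= m -> m <= n -> H i a = 0 ->
  0 < H i m -> exists2 b, a <= b < m & L i.+1 b = H i m.
Proof.
move=> lt_in le_am + e0; rewrite -(subnK le_am); elim: (m - a) => [|d IHd].
  by rewrite e0.
rewrite addSn => lt_dn x0; have IH := IHd (ltnW lt_dn).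
have early : L i.+1 (d + a) = H i (d + a).+1 ->
  exists2 b, a <= b < (d + a).+1 & L i.+1 b = H i (d + a).+1.
  by move=> e; exists (d + a) => //; lia.
have late : H i (d + a) = H i (d + a).+1 ->
  exists2 b, a <= b < (d + a).+1 & L i.+1 b = H i (d + a).+1.
  move=> e; rewrite -e; case: IH => [|b lt_b eb]; first by rewrite e.
  by exists b => //; lia.
case: (cellP lt_in lt_dn) => e1 e2 e3 e4; try by move: x0; rewrite e3.
- by apply: early.
- by case: (leqP (H i (d + a)) (L i.+1 (d + a))) => le; [apply: late|apply: early]; lia.
- by apply: late.
Qed.

(** The diagonal increment of the rank is the number of met edges among the left and bottom edges of
    the cell: 0 only at a blank, 2 only at a crossing. *)
Lemma blank_rank i j : i < n -> j < n ->
  (t i j == Blank) = (rank P i.+1 j.+1 == rank P i j).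
Proof.
case: edgesP => hl ht hb hr lt_in lt_jn.
rewrite rank_S rankS ?(ltnW lt_jn) // vedgeS -hl //.
have -> s : (s == Blank) = ~~ meets_left s && ~~ meets_bottom s by case: s.
by lia.
Qed.

Lemma crossing_rank i j : i < n -> j < n ->
  (t i j == Crossing) = (rank P i.+1 j.+1 == (rank P i j).+2).
Proof.
case: edgesP => hl ht hb hr lt_in lt_jn.
rewrite rank_S rankS ?(ltnW lt_jn) // vedgeS -hl //.
have -> s : (s == Crossing) = meets_left s && meets_bottom s by case: s.
by lia.
Qed.

End BPD.

Lemma rank_inj n (P Q : 'M[tile]_n) : is_bpd P -> is_bpd Q ->
  (forall i j, i <= n -> j <= n -> rank P i j = rank Q i j) -> P = Q.
Proof.
move=> hP hQ eqr; apply/matrixP => i j; rewrite -!tile_atE.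
have hv a b : a <= n -> b < n -> vedge P a b = vedge Q a b.
  move=> le_an lt_bn.
  have := eqr a b.+1 le_an lt_bn; rewrite !rank_S eqr ?(ltnW lt_bn) //; lia.
have hh a b : a < n -> b <= n -> hedge P a b = hedge Q a b.
  move=> lt_an le_bn.
  have := eqr a.+1 b lt_an le_bn; rewrite !rankS // eqr ?(ltnW lt_an) //; lia.
case: (is_bpdP P hP) (is_bpdP Q hQ) => [lP tP _ _] [lQ tQ _ _].
have [lti ltj] := (ltn_ord i, ltn_ord j).
apply: tile_ext; rewrite ?lP ?lQ ?tP ?tQ //; first exact: hh (ltnW _).
- by apply: hv; rewrite // ltnW.
- exact: (hh i j.+1).
- exact: (hv i.+1 j).
Qed.

(** * Demazure product and ranks *)

Section Demazure.

Variables (n : nat) (v : 'S_n) (P : 'M[tile]_n).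
Hypotheses (vex : vexillary v) (Pbpd : is_bpd P).

Local Notation w := (permn v).
Local Notation wi := (permn (v^-1)%g).
Local Notation t := (tile_at P).
Local Notation L := (vlabel P).
Local Notation H := (hlabel P).
Local Notation cnt := (label_count P).

(** * From the Demazure product to ranks and crossings *)

Section DemazureGiven.

Hypothesis dem : forall i, i < n -> H i n = (w i).+1.

Lemma label_count_demazure i x : i <= n -> x < n -> cnt i n x.+1 = (wi x < i).
Proof.
move=> + lt_xn; elim: i => [|i IHi] lt_in.
  apply/eqP; rewrite -leqn0 leqNgt; apply/negP => /label_count_gt0P[b lt_bn e].
  by have := vlabel_met Pbpd (leq0n n) lt_bn; rewrite e vedge0.
rewrite label_count_row // IHi ?(ltnW lt_in) // dem // eqSS.
by rewrite permn_eq //; lia.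
Qed.

(** At an upward elbow in an outer column [b] of row [i], the label [b.+1] has
    already exited below, and the label exiting row [i] is larger since it
    enters the row to the right of [b]: [(i, b)] would be in the Rothe diagram.
    Hence the labels of outer columns stay in their columns until they exit. *)
Lemma vlabel_outer i b : i <= n -> b < n -> outer v i b ->
  L i b = if wi b < i then b.+1 else 0.
Proof.
move: {2}(n - i) (erefl (n - i)) => k.
elim: k i b => [|k IHk] i b ek le_in lt_bn out.
  have -> : i = n by lia.
  by rewrite vlabel_bottom permn_lt.
have lt_in : i < n by lia.
have own m : b <= m -> m < n -> L i.+1 m = if wi m < i.+1 then m.+1 else 0.
  by move=> le_bm lt_mn; apply: IHk => //; [lia | apply: outer_mono out; lia].
have noup m : b <= m -> m < n -> t i m <> UpElbow.
  move=> le_bm lt_mn; case: (cellP Pbpd lt_in lt_mn) => // h1 h2 h3 h4 _.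
  have := own m le_bm lt_mn; case: ltnP => [_|h _]; first by lia.
  have := outerP _ _ _ out i m lt_in lt_mn (leqnn i) le_bm.
  have := @hlabel_after_gap _ _ Pbpd i m.+1 n lt_in lt_mn (leqnn n) h3.
  rewrite dem // => /(_ isT)[c /andP[h5 h6] e].
  by have := own c; rewrite e; case: ifP; lia.
(* The pipe turning right at [b] carries [b.+1], smaller than any label it can meet further right,
   so every crossing lets it through to the boundary. *)
have nodown : t i b = DownElbow -> w i = b.
  case: (cellP Pbpd lt_in lt_bn) => // h1 h2 h3 h4 _.
  suff pers d : b.+1 + d <= n -> H i (b.+1 + d) = b.+1.
    by have := dem lt_in; rewrite -[X in H i X](subnKC lt_bn) pers; lia.
  elim: d => [|d IHd] lt_d.
    by rewrite addn0 h3; have := own b (leqnn b) lt_bn; case: ifP; lia.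
  move: lt_d; rewrite addnS => lt_d; have {}IHd := IHd (ltnW lt_d).
  have le_b : b <= b.+1 + d by lia.
  have := own _ le_b lt_d; have := noup _ le_b lt_d.
  by case: (cellP Pbpd lt_in lt_d) => // g1 g2 g3 g4 _; case: ifP; lia.
have tot : wi b = i -> L i b <> b.+1.
  move=> e1 e2; have := label_count_demazure (ltnW lt_in) lt_bn; rewrite e1 ltnn.
  move=> e; suff : 0 < cnt i n b.+1 by rewrite e.
  by apply/label_count_gt0P; exists b.
have hle := hlabel_le Pbpd lt_in (ltnW lt_bn).
have := own b (leqnn b) lt_bn; have := noup b (leqnn b) lt_bn; move: nodown.
case: (cellP Pbpd lt_in lt_bn) => // h1 h2 h3 h4; try by case: ifP; case: ifP; lia.
move=> /(_ erefl) e _; have : wi b = i by rewrite -e permnK.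
by case: ifP; case: ifP; lia.
Qed.

(** Outer cells are stable under moving right, so the induction runs leftwards from the right
    boundary, where both ranks are [i]. *)
Lemma rank_outer i j : i <= n -> j <= n -> outer v i j ->
  rank P i j = prank v i j.
Proof.
move=> le_in; move: {2}(n - j) (erefl (n - j)) => k.
elim: k j => [|k IHk] j ek le_jn out.
  have -> : j = n by lia.
  by rewrite rank_n // prank_n.
have lt_jn : j < n by lia.
have := IHk j.+1; rewrite rank_S prank_S // -vlabel_met // vlabel_outer //.
have out' : outer v i j.+1 by apply: outer_mono out.
by case: ifP; lia.
Qed.

(** The label [y] cannot overtake a smaller label [x] on its right: if they met,
    [x] would leave the crossing through the right edge. *)
Lemma label_inversion i m x y : i <= n -> m <= n -> x < y -> y < n ->
  cnt i m x.+1 = 0 -> 0 < cnt i m y.+1 -> 0 < cnt i n x.+1 -> wi y < wi x.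
Proof.
move=> + + lt_xy lt_yn; have lt_xn := ltn_trans lt_xy lt_yn.
elim: i m => [|i IHi] m lt_in le_mn cx cy cxn.
  by move: cxn; rewrite label_count_demazure.
have le_in := ltnW lt_in.
have [b lt_bn eb] := label_count_gt0P _ _ _ _ cxn.
have le_mb : m <= b.
  rewrite leqNgt; apply/negP => lt; suff : 0 < cnt i.+1 m x.+1 by rewrite cx.
  by apply/label_count_gt0P; exists b.
have cxb : cnt i.+1 b x.+1 = 0.
  have := label_count_le1 (x := x.+1) Pbpd lt_in lt_bn isT.
  by rewrite label_countS eb eqxx; lia.
have cxb' : cnt i b x.+1 = 0.
  by have := label_count_up (x := x.+1) Pbpd (leqnSn i) lt_in (ltnW lt_bn) isT; lia.
(* Otherwise [y.+1] runs through both side edges of column [b], where [x.+1] enters from below; that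
   tile is a crossing, and the smaller label leaves it to the right. *)
have cyb : 0 < cnt i b.+1 y.+1.
  rewrite lt0n; apply/eqP => cy0.
  have cy0' := label_count_le P i y.+1 (leqnSn b).
  have r1 := label_count_row (x := y.+1) Pbpd lt_in lt_bn isT.
  have r2 := label_count_row (x := y.+1) Pbpd lt_in (ltnW lt_bn) isT.
  have le1 := label_count_le P i.+1 y.+1 le_mb.
  have le2 := label_count_le P i.+1 y.+1 (leqnSn b).
  by case: (cellP Pbpd lt_in lt_bn) => // g1 g2 g3 g4; lia.
have cyn : 0 < cnt i n y.+1 := leq_trans cyb (label_count_le P i y.+1 lt_bn).
have eqx := permn_eq v lt_in lt_xn.
have := cxn; have := cyn; rewrite !label_count_demazure // => wiy wix.
have [e|ne] := eqVneq (wi x) i; first by lia.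
have cxn' : 0 < cnt i n x.+1 by rewrite label_count_demazure //; lia.
(* The column separating the two labels on line [i] is [b] if [x.+1] goes straight up, and [b.+1]
   otherwise. *)
have [e|/eqP ne'] := eqVneq (L i b) x.+1; last first.
  by apply: (IHi b.+1) => //; rewrite label_countS cxb'; lia.
apply: (IHi b) => //; first exact: ltnW.
by move: cyb; rewrite label_countS e; lia.
Qed.

(** The larger label goes up and the smaller one right, so by [label_inversion] the larger one exits
    in a higher row. This is an inversion north-west of the cell, against [inner_increasing]. *)
Lemma inner_no_crossing i j : ~~ outer v i j -> t i j <> Crossing.
Proof.
move=> inn; have [lt_in lt_jn] := inner_lt inn.
case: (cellP Pbpd lt_in lt_jn) => // h1 h2 h3 h4 _.
have le_in := ltnW lt_in; have le_jn := ltnW lt_jn.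
have lt_lb : H i j != L i.+1 j.
  apply/eqP => e.
  have l0 : 0 < H i j by lia.
  have := hlabel_count Pbpd lt_in le_jn l0.
  have := label_count_le1 (x := H i j) Pbpd lt_in lt_jn l0.
  by rewrite label_countS -e eqxx; lia.
have hle := hlabel_le Pbpd lt_in le_jn.
have vle := vlabel_le Pbpd lt_in lt_jn.
have [x ex] : exists x, minn (H i j) (L i.+1 j) = x.+1.
  by exists (minn (H i j) (L i.+1 j)).-1; lia.
have [y ey] : exists y, maxn (H i j) (L i.+1 j) = y.+1.
  by exists (maxn (H i j) (L i.+1 j)).-1; lia.
have lt_xy : x < y by lia.
have le_yj : y <= j by lia.
rewrite ex in h3; rewrite ey in h4.
have lt_yn : y < n by lia.
have lt_xn : x < n by lia.
have cy : 0 < cnt i j.+1 y.+1 by apply/label_count_gt0P; exists j.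
have r := label_count_row (x := x.+1) Pbpd lt_in lt_jn isT.
have le1 := label_count_le1 (x := x.+1) Pbpd lt_in lt_jn isT.
have le2 := label_count_le P i.+1 x.+1 lt_jn.
have cyn : 0 < cnt i n y.+1 := leq_trans cy (label_count_le P i y.+1 lt_jn).
have := le2; rewrite r h3 eqxx label_count_demazure // => wix.
have := cyn; rewrite label_count_demazure // => wiy.
have inv : wi y < wi x.
  have [->|ne] := eqVneq (wi x) i; first by lia.
  apply: (@label_inversion i j.+1) => //; first by move: r; rewrite h3 eqxx; lia.
  by rewrite label_count_demazure //; lia.
have := inner_increasing vex inn inv; rewrite !permnKV //; lia.
Qed.

End DemazureGiven.

(** * From ranks and crossings to the Demazure product *)

Section RankGiven.

Hypothesis rk : forall i j, i <= n -> j <= n -> outer v i j ->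
  rank P i j = prank v i j.
Hypothesis noX : forall i j, ~~ outer v i j -> t i j <> Crossing.

Lemma vedge_outer i b : i <= n -> b < n -> outer v i b -> vedge P i b = (wi b < i).
Proof.
move=> le_in lt_bn out; have out' : outer v i b.+1 by apply: outer_mono out.
have := rk le_in lt_bn out'; have := rk le_in (ltnW lt_bn) out.
by rewrite rank_S prank_S //; lia.
Qed.

Lemma hedge_outer i b : i < n -> b <= n -> outer v i b -> hedge P i b = (w i < b).
Proof.
move=> lt_in le_bn out; have out' : outer v i.+1 b by apply: outer_mono out.
have := rk lt_in le_bn out'; have := rk (ltnW lt_in) le_bn out.
by rewrite rankS // prankS //; lia.
Qed.

(** Invariant carried upwards from the bottom line. The last two clauses mirror
    [label_count_demazure] and [vlabel_outer]; sortedness serves to identify the exiting label where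
    there are no crossings. *)
Definition sorted_line (i : nat) : Prop :=
  [/\ forall a b, a < b -> b < n -> L i a != 0 -> L i b != 0 -> L i a < L i b,
      forall x, x < n -> cnt i n x.+1 = (wi x < i)
    & forall b, b < n -> outer v i b -> L i b = if wi b < i then b.+1 else 0].

Section Row.

Variable i : nat.
Hypotheses (lt_in : i < n) (line : sorted_line i.+1).

(** Without crossings, no bottom edge is met between the turn of a pipe and column [m]. Its label is
    thus the rightmost one that entered from below, hence the largest by sortedness. *)
Lemma hlabel_max m a : m <= n -> (forall b, b < m -> ~~ outer v i b) -> a < m ->
  L i.+1 a != 0 -> H i m != 0 -> L i.+1 a <= H i m.
Proof.
have [srt _ _] := line.
move=> + + + a0; elim: m => // m IHm lt_mn inn.
have {}IHm : a < m -> H i m != 0 -> L i.+1 a <= H i m.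
  by apply: IHm; [lia | move=> b lt_b; apply: inn; lia].
have := noX (inn m (ltnSn m)).
case: (cellP Pbpd lt_in lt_mn) => h1 h2 h3 h4 nX; rewrite h3 // ltnS leq_eqVlt.
- case/orP => [/eqP-> //|lt] _; apply: ltnW; exact: srt.
- case/orP => [/eqP ea|lt]; [by rewrite ea h2 in a0 | exact: IHm].
Qed.

Lemma hlabel_persist m : m <= n -> w i < m -> outer v i m -> H i m = (w i).+1 ->
  H i n = (w i).+1.
Proof.
move=> le_mn lt_w out e.
suff pers d : m + d <= n -> H i (m + d) = (w i).+1.
  by have := pers (n - m); rewrite subnKC //; apply.
elim: d => [|d IHd]; first by rewrite addn0.
rewrite addnS => lt_d; have {}IHd := IHd (ltnW lt_d).
have out' : outer v i (m + d).+1 by apply: outer_mono out; lia.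
have outL : outer v i.+1 (m + d) by apply: outer_mono out; lia.
have := hedge_outer lt_in lt_d out'; rewrite -hlabel_met //.
have [_ _ own] := line; have := own _ lt_d outL.
case: (cellP Pbpd lt_in lt_d) => h1 h2 h3 h4; case: ifP; lia.
Qed.

(** If [(i, w i)] is outer, the pipe of that column turns right there. Otherwise the label reaching
    the first outer column is at least [(w i).+1] by [hlabel_max]; a larger one would exit higher up
    and create an inversion that [inner_increasing] forbids. *)
Lemma hlabel_exit : H i n = (w i).+1.
Proof.
have lt_wn : w i < n by exact: permn_lt.
have [srt tot own] := line.
case: (boolP (outer v i (w i))) => [out|inn].
  have out' : outer v i (w i).+1 by apply: outer_mono out.
  have outL : outer v i.+1 (w i) by apply: outer_mono out.
  apply: (@hlabel_persist (w i).+1) => //.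
  have := hedge_outer lt_in lt_wn out'; rewrite -hlabel_met //.
  have := hedge_outer lt_in (ltnW lt_wn) out.
  rewrite -hlabel_met ?(ltnW lt_wn) //.
  have := own _ lt_wn outL; rewrite permnK // ltnSn ltnn.
  by case: (cellP Pbpd lt_in lt_wn) => h1 h2 h3 h4; lia.
have out_n : outer v i n by apply: contraT => /inner_lt; lia.
have ex : exists j, outer v i j by exists n.
case: (ex_minnP ex) => j out minj.
have le_jn : j <= n by exact: minj.
have inj b : b < j -> ~~ outer v i b.
  by move=> lt; apply: contraL lt => /minj; lia.
have lt_wj : w i < j.
  by rewrite ltnNge; apply: contra inn => le; apply: outer_mono out.
apply: (@hlabel_persist j) => //.
have Hj : H i j != 0 by rewrite hlabel_met // hedge_outer.
have /label_count_gt0P[a lt_an ea] : 0 < cnt i.+1 n (w i).+1.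
  by rewrite tot // permnK // ltnSn.
have lt_aj : a < j.
  rewrite ltnNge; apply/negP => le_ja.
  have outL : outer v i.+1 a by apply: outer_mono out.
  by have := own _ lt_an outL; rewrite ea; case: ifP; lia.
have le_w : (w i).+1 <= H i j by rewrite -ea hlabel_max // ea.
have hle := hlabel_le Pbpd lt_in le_jn.
have [y ey] : exists y, H i j = y.+1 by exists (H i j).-1; lia.
have lt_yn : y < n by lia.
have : 0 < cnt i.+1 n y.+1.
  apply: leq_trans (label_count_le P i.+1 y.+1 le_jn).
  by rewrite -ey hlabel_count //; lia.
rewrite tot // => wiy.
have [eq|ne] := eqVneq (wi y) i; first by rewrite ey -eq permnKV.
have lt_i : wi y < i by lia.
have /(inner_increasing vex)/(_ lt_i (leqnn i)) : ~~ outer v i j.-1.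
  by apply: inj; lia.
by rewrite permnKV //; lia.
Qed.

Lemma sorted_line_step : sorted_line i.
Proof.
have [srt tot own] := line; have le_in := ltnW lt_in.
have own' b : b < n -> outer v i b -> L i b = if wi b < i then b.+1 else 0.
  move=> lt_bn out; have outL : outer v i.+1 b by apply: outer_mono out.
  have hle := hlabel_le Pbpd lt_in (ltnW lt_bn).
  have := own _ lt_bn outL; have := vedge_outer le_in lt_bn out.
  rewrite -vlabel_met //.
  by case: (cellP Pbpd lt_in lt_bn) => h1 h2 h3 h4; case: ifP; case: ifP; lia.
split=> // [a b lt_ab lt_bn a0 b0|x lt_xn].
  have lt_an := ltn_trans lt_ab lt_bn.
  have vle := vlabel_le Pbpd le_in lt_an.
  case: (boolP (outer v i b)) => [out|inn].
    by have := own' _ lt_bn out; case: ifP; lia.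
  have [c le_ca ec] : exists2 c, c <= a & L i.+1 c = L i a.
    by apply: vlabel_top; lia.
  have c0 : L i.+1 c != 0 by rewrite ec.
  have innb d : d < b -> ~~ outer v i d.
    by move=> lt; apply: contra inn; apply: outer_mono => //; lia.
  have := noX inn; have ninj := @vlabel_inj _ _ Pbpd i a b le_in lt_an lt_bn a0.
  have := srt c b; have := hlabel_max (ltnW lt_bn) innb _ c0; move: c0; rewrite ec.
  by case: (cellP Pbpd lt_in lt_bn) => // h1 h2 h3 h4; lia.
have := tot _ lt_xn; rewrite label_count_row // hlabel_exit eqSS permn_eq //; lia.
Qed.

End Row.

Lemma demazure_rank i : i < n -> H i n = (w i).+1.
Proof.
move=> lt_in; apply: hlabel_exit => //.
have : i.+1 <= n by []; move: {2}(n - i.+1) (erefl (n - i.+1)) => k.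
elim: k {lt_in} i.+1 => [|k IHk] j ek le_jn; last first.
  have lt_jn : j < n by lia.
  apply: sorted_line_step => //.
  by apply: IHk => //; lia.
have -> : j = n by lia.
split=> [a b lt_ab lt_bn|x lt_xn|b lt_bn _]; rewrite ?vlabel_bottom //.
  by have := permn_lt (v^-1)%g lt_xn; rewrite label_count_bottom; lia.
by rewrite permn_lt.
Qed.

End RankGiven.

End Demazure.

(** * The Rothe diagram and the shape [mu v] *)

Lemma nat_ivt (f : nat -> nat) k m : f 0 < k -> k <= f m ->
  exists e, [/\ e < m, f e < k & k <= f e.+1].
Proof.
move=> f0; elim: m => [|m IHm] fm; first by lia.
case: (leqP k (f m)) => [/IHm[e [lt_em h1 h2]]|lt]; last by exists m.
by exists e; split=> //; lia.
Qed.

(** The count is a part of the conjugate partition; being invariant under permutation, it removes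
    the sorting from [mu]. *)
Lemma nth_sorted_geq s k l : sorted geq s -> 0 < l ->
  (l <= nth 0 s k) = (k < count (leq l) s).
Proof.
move=> + l0; elim: s k => [|x s IHs] k srt; first by rewrite nth_nil /=; lia.
have srt' : sorted geq s := path_sorted srt.
have trans_geq : transitive geq by move=> a b c; rewrite /=; lia.
have lex : all (geq x) s := order_path_min trans_geq srt.
case: k => [|k] /=; last rewrite IHs //.
  case: (leqP l x) => // lt; apply/esym/negbTE.
  rewrite add0n -leqNgt leqn0 -leqn0 leqNgt -has_count; apply/hasPn => y /(allP lex) /=.
  lia.
case: (leqP l x) => // lt; suff -> : count (leq l) s = 0 by [].
apply/eqP; rewrite -leqn0 leqNgt -has_count; apply/hasPn => y /(allP lex) /=.
by lia.
Qed.

Section Rothe.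

Variables (n : nat) (v : 'S_n).

Local Notation w := (permn v).
Local Notation wi := (permn (v^-1)%g).

Lemma prank_leS i k j : i <= k -> prank v i j <= prank v k j.
Proof.
move=> le_ik; rewrite -(subnK le_ik); elim: (k - i) => // d IHd.
by rewrite addSn prankS; lia.
Qed.

Lemma prank_le i j : prank v i j <= i.
Proof. by elim: i => [|i IHi]; rewrite ?prank0 // prankS; lia. Qed.

Lemma prank_blank i j : i < n -> j < n ->
  (prank v i.+1 j.+1 == prank v i j) = (j < w i) && (i < wi j).
Proof.
move=> lt_in lt_jn; rewrite prankS prank_S ?(ltnW lt_in) //.
by have := permn_eq v lt_in lt_jn; lia.
Qed.

Definition row_blanks (a m : nat) : nat := \sum_(b < m) ((b < w a) && (a < wi b)).

Lemma row_blanks_prank a m : a < n -> m <= w a -> row_blanks a m + prank v a m = m.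
Proof.
move=> lt_an; have lt_wn := permn_lt v lt_an.
elim: m => [|m IHm] le_m; first by rewrite prank_0 /row_blanks big_ord0.
have lt_mn : m < n by lia.
rewrite /row_blanks big_ord_recr /= -/(row_blanks a m) prank_S ?(ltnW lt_an) //.
have := IHm (ltnW le_m); have := permn_eq v lt_an lt_mn; lia.
Qed.

Lemma row_blanks_le a m p : m <= p -> row_blanks a m <= row_blanks a p.
Proof.
move=> le_mp; rewrite -(subnK le_mp); elim: (p - m) => // k.
by rewrite addSn /row_blanks big_ord_recr /=; lia.
Qed.

Lemma row_blanks_stop a m : w a <= m -> row_blanks a m = row_blanks a (w a).
Proof.
move=> le; rewrite -(subnK le); elim: (m - w a) => // k IHk.
by rewrite addSn {1}/row_blanks big_ord_recr /= -/(row_blanks _ _) IHk; lia.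
Qed.

Lemma code_row_blanks (a : 'I_n) : code v a = row_blanks a n.
Proof.
rewrite /code -sum1_card big_mkcond; apply: eq_bigr => b _.
by rewrite inE rotheE; case: andP.
Qed.

Lemma mem_young_mu k l :
  ((k, l) \in young (mu v)) =
  [&& 0 < k, 0 < l & k <= \sum_(a < n) (l <= row_blanks a n)].
Proof.
rewrite mem_young /part; case: k => [|k] //=; case: l => [|l] //=.
rewrite nth_sorted_geq //; last first.
  by apply: sort_sorted => a b; rewrite /=; lia.
rewrite (seq.permP (permEl (perm_sort _ _))) count_map -sum1_count big_enum_cond /=.
rewrite big_mkcond; congr (_ < _); apply: eq_bigr => a _.
by rewrite /= code_row_blanks; case: leqP.
Qed.

(** The cell is the [l]-th of its row. Each row [b <= a] with [j < w b] has at least as many cells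
    up to column [j], and there are [a.+1 - prank v a j] such rows. *)
Lemma rothe_index_bound a j l : a < n -> (j < w a) && (a < wi j) ->
  l + prank v a j = j.+1 ->
  l <= row_blanks a n /\
  a.+1 - prank v a j <= \sum_(b < n) (l <= row_blanks b n).
Proof.
move=> lt_an hb el; have /andP[lt_jw lt_aw] := hb.
have lt_wn := permn_lt v lt_an; have lt_jn := ltn_trans lt_jw lt_wn.
have row b : b <= a -> j < w b -> l <= row_blanks b n.
  move=> le_ba lt_jb; have lt_bn := leq_ltn_trans le_ba lt_an.
  have lt_wbn := permn_lt v lt_bn.
  have := row_blanks_prank lt_bn lt_jb.
  have := row_blanks_le b lt_jn; have := prank_leS j.+1 le_ba.
  by rewrite (prank_S _ (ltnW lt_an)) //; lia.
split; first exact: row.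
have -> : a.+1 - prank v a j = \sum_(b < a.+1) (j < w b).
  have : \sum_(b < a.+1) (j < w b) + prank v a.+1 j.+1 = a.+1.
    rewrite /prank -big_split /= -[RHS]card_ord -sum1_card.
    by apply: eq_bigr => b _; lia.
  by have := prank_blank lt_an lt_jn; rewrite hb => /eqP ->; lia.
rewrite (big_ord_widen n (fun b => (j < w b) : nat) lt_an) big_mkcond.
by apply: leq_sum => b _; case: ifP => // le; have := row b le; lia.
Qed.

Lemma row_blanks_nth a l : a < n -> 0 < l -> l <= row_blanks a n ->
  exists j, [/\ j < n, (j < w a) && (a < wi j) & l + prank v a j = j.+1].
Proof.
move=> lt_an l0; have lt_wn := permn_lt v lt_an.
rewrite row_blanks_stop ?(ltnW lt_wn) // => le.
have [|j [lt_j h1 h2]] := nat_ivt _ le; first by rewrite /row_blanks big_ord0.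
have lt_jn := ltn_trans lt_j lt_wn.
have := row_blanks_prank lt_an lt_j; have := row_blanks_prank lt_an (ltnW lt_j).
rewrite prank_S ?(ltnW lt_an) //; have := permn_eq v lt_an lt_jn => e e1 e2.
by exists j; split=> //; lia.
Qed.

Lemma diag_le (r : nat -> nat -> nat) i j d :
  (forall a b, ~~ outer v a b -> r a.+1 b.+1 <= (r a b).+1) ->
  (forall e, e < d -> ~~ outer v (i + e) (j + e)) ->
  r (i + d) (j + d) <= r i j + d.
Proof.
move=> hr; elim: d => [|d IHd] inn; first by rewrite !addn0.
have := hr _ _ (inn d (ltnSn d)); rewrite !addnS => h.
have : r (i + d) (j + d) <= r i j + d by apply: IHd => e le; apply: inn; lia.
lia.
Qed.

Hypothesis vex : vexillary v.

Let Sl l := [set c : 'I_n * 'I_n in rothe v | l + prank v c.1 c.2 == c.2.+1].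

(** Equal indices force a common diagonal and a rank difference equal to the distance. But the rank
    does not grow at the first cell, and by [prank_inner] grows by at most one at each later
    step. *)
Lemma diag_index_inj l : {in Sl l &, injective
  (fun c : 'I_n * 'I_n => c.1.+1 - prank v c.1 c.2)}.
Proof.
suff lt_neq c c' : c \in Sl l -> c' \in Sl l -> c.1 < c'.1 ->
    c.1.+1 - prank v c.1 c.2 = c'.1.+1 - prank v c'.1 c'.2 -> False.
  move=> c c' hc hc' e; have [lt|lt|e1] := ltngtP c.1 c'.1.
  - by case: (lt_neq c c').
  - by case: (lt_neq c' c).
  case: c c' hc hc' e e1 => [a b] [a' b'] /=; rewrite !inE /=.
  move=> /andP[_ /eqP h] /andP[_ /eqP h'] e /val_inj ea; subst a'.
  have := prank_le a b; have := prank_le a b' => p1 p2.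
  by congr (_, _); apply: val_inj => /=; lia.
case: c c' => [a b] [a' b']; rewrite !inE /= -!permnE.
move=> /andP[hc /eqP h] /andP[hc' /eqP h'] lt e.
have p1 := prank_le a b; have p2 := prank_le a' b'.
have eqd : a + b' = a' + b by lia.
have eb : prank v a.+1 b.+1 = prank v a b by apply/eqP; rewrite prank_blank // hc.
have inn : ~~ outer v a' b'.
  by apply/innerP; exists a', b'; rewrite !ltn_ord.
have := @diag_le (prank v) a.+1 b.+1 (a' - a.+1) (prank_inner vex).
have -> : a.+1 + (a' - a.+1) = a' by lia.
have -> : b.+1 + (a' - a.+1) = b' by lia.
suff innd e' : e' < a' - a.+1 -> ~~ outer v (a.+1 + e') (b.+1 + e').
  by move=> /(_ innd); lia.
by move=> lt_e; apply: contra inn; apply: outer_mono; lia.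
Qed.

(** In 1-based coordinates, [(i, j) |-> (i - r, j - r)], where [r] is the rank
    at [(i, j)], maps the Rothe diagram bijectively onto the shape [mu v]: a cell of column [l] in the image comes from the [l]-th cell of
    some row of the Rothe diagram. *)
Lemma young_mu_rothe k l :
  reflect (exists i j, [/\ i < n, j < n, (j < w i) && (i < wi j),
             k + prank v i j = i.+1 & l + prank v i j = j.+1])
          ((k, l) \in young (mu v)).
Proof.
rewrite mem_young_mu; apply: (iffP and3P) => [[k0 l0 le_k]|]; last first.
  case=> i [j [lt_in lt_jn hb ek el]].
  have [h1 h2] := rothe_index_bound lt_in hb el; have := prank_le i j.
  have := row_blanks_prank lt_in; move: hb => /andP[lt_jw _].
  move/(_ j (ltnW lt_jw)) => h3 h4; split; lia.
set f := fun c : 'I_n * 'I_n => c.1.+1 - prank v c.1 c.2.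
set h := \sum_(a < n) _ in le_k.
have bound c : c \in Sl l -> 0 < f c <= h.
  case: c => a b; rewrite inE rotheE /= => /andP[hb /eqP el].
  have [_] := rothe_index_bound (ltn_ord a) hb el.
  by rewrite /f /= -/h; have := prank_le a b; lia.
have card : h <= #|Sl l|.
  have -> : h = #|[set a : 'I_n | l <= row_blanks a n]|.
    rewrite -sum1_card big_mkcond; apply: eq_bigr => a _.
    by rewrite inE; case: leqP.
  apply: leq_trans (leq_imset_card (fun c => c.1) (Sl l)).
  apply/subset_leq_card/subsetP => a; rewrite inE => le.
  have [j [lt_jn hb el]] := row_blanks_nth (ltn_ord a) l0 le.
  apply/imsetP; exists (a, Ordinal lt_jn) => //.
  by rewrite inE rotheE /= hb el eqxx.
(* Pigeonhole: [f] is injective from at least [h] cells into [1, ..., h], so it reaches [k]. *)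
have [] := @uniq_min_size _ [seq f c | c <- enum (Sl l)] (iota 1 h).
- rewrite map_inj_in_uniq ?enum_uniq // => c c'; rewrite !mem_enum.
  exact: diag_index_inj.
- move=> x /mapP[c]; rewrite mem_enum => /bound + ->.
  by rewrite mem_iota; lia.
- by rewrite size_iota size_map -cardE.
move=> _ /(_ k); rewrite mem_iota.
have -> : 1 <= k < 1 + h by lia.
case/mapP => -[a b]; rewrite mem_enum inE rotheE /= => /andP[hb /eqP el] ek.
by exists a, b; split=> //; rewrite ek /f /=; have := prank_le a b; lia.
Qed.

(** These are the first outer points of the diagonals, where the fixed outside ranks meet the
    inside. *)
Definition border (a b : nat) : bool :=
  outer v a b && [|| a == 0, b == 0 | ~~ outer v a.-1 b.-1].

(** Along a diagonal inside [lambda v], row minus [prank] rises by one exactly at the cells of the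
    Rothe diagram, and stays constant elsewhere; its value at the border therefore bounds the
    indices [k] attained. *)
Lemma border_young a b k l : a <= n -> b <= n -> border a b ->
  0 < k -> 0 < l -> a + l = b + k ->
  ((k, l) \in young (mu v)) = (k + prank v a b <= a).
Proof.
move=> le_an le_bn /andP[out bd] k0 l0 diag; apply/young_mu_rothe/idP.
  case=> i [j [lt_in lt_jn hb ek el]].
  have inn : ~~ outer v i j by apply/innerP; exists i, j; split.
  have lt_ia : i < a.
    by rewrite ltnNge; apply: contra inn => le; apply: outer_mono out; lia.
  have innb : ~~ outer v a.-1 b.-1 by case/or3P: bd => //; lia.
  have := @diag_le (prank v) i.+1 j.+1 (a - i.+1) (prank_inner vex).
  have -> : i.+1 + (a - i.+1) = a by lia.
  have -> : j.+1 + (a - i.+1) = b by lia.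
  have := prank_blank lt_in lt_jn; rewrite hb => /eqP ->.
  suff innd e : e < a - i.+1 -> ~~ outer v (i.+1 + e) (j.+1 + e).
    by move=> /(_ innd); lia.
  by move=> lt_e; apply: contra innb; apply: outer_mono; lia.
move=> le_k; set s := minn a b.
have r0 : prank v (a - s) (b - s) = 0.
  have [e|e] : a - s = 0 \/ b - s = 0 by lia.
    by rewrite e prank0.
  by rewrite e prank_0.
have [||e [lt_es h1 h2]] :=
  @nat_ivt (fun e => a - s + e - prank v (a - s + e) (b - s + e)) k s.
- by rewrite !addn0 r0; lia.
- have -> : a - s + s = a by lia.
  by have -> : b - s + s = b; lia.
set i := a - s + e in h1 h2; set j := b - s + e in h1 h2.
have ei : a - s + e.+1 = i.+1 by lia.
have ej : b - s + e.+1 = j.+1 by lia.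
rewrite ei ej in h2.
have lt_in : i < n by lia.
have lt_jn : j < n by lia.
have p1 := prank_le i j; have p2 := prank_le i.+1 j.+1.
have p3 : prank v i j <= prank v i.+1 j.+1.
  by rewrite prankS prank_S ?(ltnW lt_in) //; lia.
have eqp : prank v i.+1 j.+1 = prank v i j by lia.
exists i, j; split=> //; try lia.
by rewrite -prank_blank // eqp.
Qed.

Lemma border_exists i j : ~~ outer v i j ->
  exists d, [/\ i + d <= n, j + d <= n, 0 < d, border (i + d) (j + d)
    & forall e, e < d -> ~~ outer v (i + e) (j + e)].
Proof.
move=> inn; have ex : exists d, outer v (i + d) (j + d).
  by exists n; apply: contraT => /inner_lt; lia.
case: (ex_minnP ex) => d out mind.
have innd e : e < d -> ~~ outer v (i + e) (j + e).
  by move=> lt; apply: contraL lt => /mind; lia.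
have d0 : 0 < d by case: d out {mind innd} => //; rewrite !addn0 (negbTE inn).
have inn1 : ~~ outer v (i + d.-1) (j + d.-1) by apply: innd; lia.
have [h1 h2] := inner_lt inn1.
exists d; split=> //; try lia.
rewrite /border out; have -> : (i + d).-1 = i + d.-1 by lia.
by have -> : (j + d).-1 = j + d.-1; [lia | rewrite inn1 !orbT].
Qed.

End Rothe.

(** * Ranks from tableaux *)

(** Such arrays are the corner-sum matrices of alternating sign matrices; the increments along the
    four sides of a cell determine its tile. *)
Lemma rank_surj n (R : nat -> nat -> nat) :
  (forall j, j <= n -> R 0 j = 0) -> (forall i, i <= n -> R i 0 = 0) ->
  (forall j, j <= n -> R n j = j) -> (forall i, i <= n -> R i n = i) ->
  (forall i j, i < n -> j <= n -> R i j <= R i.+1 j <= (R i j).+1) ->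
  (forall i j, i <= n -> j < n -> R i j <= R i j.+1 <= (R i j).+1) ->
  exists2 P : 'M[tile]_n, is_bpd P
    & forall i j, i <= n -> j <= n -> rank P i j = R i j.
Proof.
move=> R0 R_0 Rn R_n hR vR.
pose T i j := tile_of_edges (R i.+1 j != R i j) (R i j.+1 != R i j)
  (R i.+1 j.+1 != R i j.+1) (R i.+1 j.+1 != R i.+1 j).
pose P : 'M[tile]_n := (\matrix_(i, j) T i j)%R.
have PE i j : i < n -> j < n -> tile_at P i j = T i j.
  by move=> li lj; rewrite (tile_atE P (Ordinal li) (Ordinal lj)) mxE.
have TP i j : i < n -> j < n ->
    [/\ meets_left (T i j) = (R i.+1 j != R i j),
        meets_top (T i j) = (R i j.+1 != R i j),
        meets_right (T i j) = (R i.+1 j.+1 != R i j.+1)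
      & meets_bottom (T i j) = (R i.+1 j.+1 != R i.+1 j)].
  move=> li lj; apply: tile_of_edgesP.
  have := hR i j li (ltnW lj); have := hR i j.+1 li lj.
  by have := vR i j (ltnW li) lj; have := vR i.+1 j li lj; lia.
have vE i j : i <= n -> j < n -> vedge P i j = (R i j.+1 != R i j).
  case: i => [|i] li lj; first by rewrite vedge0 !R0 // ltnW.
  by rewrite vedgeS PE //; case: (TP i j li lj).
have hE i j : i < n -> j <= n -> hedge P i j = (R i.+1 j != R i j).
  case: j => [|j] li lj; first by rewrite hedge0 !R_0 // ltnW.
  by rewrite hedgeS PE //; case: (TP i j li lj).
exists P.
  apply/is_bpdP; split=> [i j li lj|i j li lj|j lj|i li].
  - by rewrite hE ?PE ?(ltnW lj) //; case: (TP i j li lj).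
  - by rewrite vE ?PE ?(ltnW li) //; case: (TP i j li lj).
  - by rewrite vE // !Rn ?(ltnW lj) //; lia.
  - by rewrite hE // !R_n ?(ltnW li) //; lia.
move=> i j li; elim: j => [|j IHj] lj; first by rewrite rank_0 R_0.
by rewrite rank_S IHj ?(ltnW lj) // vE //; have := vR i j li lj; lia.
Qed.

Lemma mem_coords_blanks n (P : 'M[tile]_n) x y :
  reflect (exists i j, [/\ i < n, j < n, x = i.+1, y = j.+1
             & tile_at P i j = Blank])
          ((x, y) \in coords (blanks P)).
Proof.
apply: (iffP imageP) => [[[i j]]|[i [j [li lj -> -> e]]]].
  by rewrite inE /= => /eqP e [-> ->]; exists i, j; rewrite tile_atE.
exists (Ordinal li, Ordinal lj) => //.
by rewrite inE /= -tile_atE e.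
Qed.

Section Tableau.

Variables (la : seq nat) (T : tableau la) (N : nat).

(** The tableau extended by [0] on the axes, and by large entries outside of
    the shape, which keeps it semistandard. *)
Definition ext (k l : nat) : nat :=
  if insub (k, l) is Some c then T c
  else if (k == 0) || (l == 0) then 0 else N + k.

Variant ext_spec k l : nat -> Type :=
| ExtIn (c : seq_sub (young la)) of
    val c = (k, l) & (k, l) \in young la & 0 < k & 0 < l :
    ext_spec k l (T c)
| ExtAxis of (k, l) \notin young la & (k == 0) || (l == 0) : ext_spec k l 0
| ExtOut of (k, l) \notin young la & 0 < k & 0 < l : ext_spec k l (N + k).

Lemma extP k l : ext_spec k l (ext k l).
Proof.
rewrite /ext; case: insubP => [c mem ec|nmem].
  by have := mem; rewrite mem_young => /and3P[k0 l0 _]; constructor.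
by case: ifP => e; constructor => //; lia.
Qed.

Lemma ext_in (c : seq_sub (young la)) : ext (val c).1 (val c).2 = T c.
Proof. by rewrite /ext -surjective_pairing valK. Qed.

Lemma ext0 k : ext k 0 = 0.
Proof. by case: extP => // c; lia. Qed.

Lemma ext_0 l : ext 0 l = 0.
Proof. by case: extP => // c; lia. Qed.

Lemma trank_exists a b : exists s, ext (a - s) (b - s) <= a.
Proof. by exists a; rewrite subnn ext_0. Qed.

(** The number of cells on the diagonal of [(a, b)], weakly above row [a],
    that are not positions of the tableau. *)
Definition trank (a b : nat) : nat := ex_minn (trank_exists a b).

Lemma trankP a b : ext (a - trank a b) (b - trank a b) <= a.
Proof. by rewrite /trank; case: ex_minnP. Qed.

Lemma trank_min a b s : ext (a - s) (b - s) <= a -> trank a b <= s.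
Proof. by rewrite /trank; case: ex_minnP => m _; apply. Qed.

Lemma trank0 b : trank 0 b = 0.
Proof. by apply/eqP; rewrite -leqn0 trank_min // ext_0. Qed.

Lemma trank_0 a : trank a 0 = 0.
Proof. by apply/eqP; rewrite -leqn0 trank_min // ext0. Qed.

Lemma trank_le a b : trank a b <= minn a b.
Proof.
rewrite leq_min !trank_min // subnn ?ext0 ?ext_0 //.
Qed.

Hypotheses (la_sorted : sorted geq la) (ssT : semistandard T)
  (T_le : forall c : seq_sub (young la), T c <= N).

Lemma young_sub i j k l : (k, l) \in young la -> 0 < i <= k -> 0 < j <= l ->
  (i, j) \in young la.
Proof.
rewrite !mem_young => /and3P[k0 l0 le_l] /andP[i0 le_ik] /andP[j0 le_jl].
rewrite i0 j0 (leq_trans le_jl) // (leq_trans le_l) // /part.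
have trans_geq : transitive geq by move=> a b c; rewrite /=; lia.
case: (ltnP k.-1 (size la)) => lt; last by rewrite (nth_default _ lt).
apply: (sorted_leq_nth trans_geq leqnn) => //; rewrite ?inE; lia.
Qed.

Lemma semistandard_row (c d : seq_sub (young la)) :
  (val c).1 = (val d).1 -> (val c).2 <= (val d).2 -> T c <= T d.
Proof.
case/and3P: ssT => _ /forallP/(_ c)/forallP/(_ d)/implyP h _ e1 e2.
by apply: h; rewrite e1 eqxx.
Qed.

Lemma semistandard_col (c d : seq_sub (young la)) :
  (val c).2 = (val d).2 -> (val c).1 < (val d).1 -> T c < T d.
Proof.
case/and3P: ssT => _ _ /forallP/(_ c)/forallP/(_ d)/implyP h e1 e2.
by apply: h; rewrite e1 eqxx.
Qed.

Lemma ext_row k l : ext k l <= ext k l.+1.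
Proof.
case: (extP k l) => // [c ec mc k0 l0|nc k0 l0].
  case: (extP k l.+1) => [d ed _ _ _||_ _ _]; [|lia|].
    by apply: semistandard_row; rewrite ec ed /=.
  by apply: leq_trans (T_le c) _; lia.
case: (extP k l.+1) => [d ed md _ _||_ _ _]; [|lia|by []].
by case/negP: nc; apply: (young_sub md); lia.
Qed.

Lemma ext_col k l : 0 < l -> ext k l < ext k.+1 l.
Proof.
move=> l0; case: (extP k.+1 l) => [d ed md _ _||nd _ _]; last 2 first.
- by move=> _; lia.
- case: (extP k l) => [c _ _ _ _|_ _|_ _ _]; try lia.
  by have := T_le c; lia.
case: (extP k l) => [c ec _ _ _|_ _|nc k0 _].
- by apply: semistandard_col; rewrite ec ed /=.
- by case/and3P: ssT => /forallP/(_ d).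
by case/negP: nc; apply: (young_sub md); lia.
Qed.

Lemma ext_ge k l : 0 < l -> k <= ext k l.
Proof.
move=> l0; elim: k => // k IHk; exact: leq_ltn_trans IHk (ext_col k l0).
Qed.

Lemma ext_diag k l d : ext k l <= ext (k + d) (l + d).
Proof.
elim: d => [|d IHd]; first by rewrite !addn0.
rewrite !addnS (leq_trans IHd) // (leq_trans (ext_row _ _)) // ltnW //.
exact: ext_col.
Qed.

Lemma ext_diag_lt k l d : 0 < d -> 0 < l -> ext k l < ext (k + d) (l + d).
Proof.
case: d => // d _ l0; rewrite !addnS (leq_ltn_trans (ext_diag k l d)) //.
rewrite (leq_ltn_trans (ext_row _ _)) //; exact: ext_col.
Qed.

Lemma tableau_ge (c : seq_sub (young la)) : (val c).1 <= T c.
Proof.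
rewrite -ext_in ext_ge //; have := valP c.
by rewrite (surjective_pairing (val c)) mem_young => /and3P[].
Qed.

Lemma trank_v a b : trank a b <= trank a b.+1 <= (trank a b).+1.
Proof.
apply/andP; split; apply: trank_min; last first.
  rewrite subSS; case: (posnP (b - trank a b)) => [->|b0]; first by rewrite ext0.
  apply: leq_trans (trankP a b); rewrite subnS.
  by case: (a - _) => // k; rewrite /= ltnW // ext_col.
have := trankP a b.+1; have := trank_le a b.+1; set s := trank a b.+1 => le h.
case: (leqP s b) => le_sb; last by have -> : b - s = 0; [lia | rewrite ext0].
by rewrite subSn // in h; apply: leq_trans (ext_row _ _) h.
Qed.

(** The lower bound needs strict columns, since the threshold drops from [a.+1] to [a]; the upper
    one only needs weak rows. In [trank_v] rows give the lower bound and columns the upper one. *)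
Lemma trank_h a b : trank a b <= trank a.+1 b <= (trank a b).+1.
Proof.
apply/andP; split; apply: trank_min; last first.
  rewrite subSS subnS; apply: leq_trans (leqnSn a).
  apply: leq_trans (trankP a b); case: (b - _) => // l; exact: ext_row.
have := trankP a.+1 b; have := trank_le a.+1 b; set s := trank a.+1 b => le h.
case: (leqP s a) => le_sa; last by have -> : a - s = 0; [lia | rewrite ext_0].
case: (posnP (b - s)) => [->|b0]; first by rewrite ext0.
by rewrite subSn // in h; rewrite -ltnS (leq_trans (ext_col _ b0)).
Qed.

Lemma trank_d a b : trank a b <= trank a.+1 b.+1 <= (trank a b).+1.
Proof.
apply/andP; split.
  have /andP[h _] := trank_v a b; have /andP[h' _] := trank_h a b.+1; lia.
by apply: trank_min; rewrite !subSS (leq_trans (trankP a b)).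
Qed.

(** Minimality makes the next entry down the diagonal exceed [a], and a constant [trank] makes it at
    most [a.+1]. As [a < N], it cannot be one of the filling values [N + k]. *)
Lemma trank_blank a b : a < N ->
  trank a.+1 b.+1 = trank a b <->
  exists c : seq_sub (young la), T c = a.+1 /\ T c + (val c).2 - (val c).1 = b.+1.
Proof.
move=> lt_aN; split=> [e|[c [e1 e2]]].
  have := trank_le a b; have := trankP a.+1 b.+1; rewrite e.
  set s := trank a b => h le.
  have gt : a < ext (a.+1 - s) (b.+1 - s).
    case: (posnP s) => [->|s0]; first by rewrite !subn0 ext_ge.
    rewrite ltnNge; apply/negP => h'.
    have : s <= s.-1; last by lia.
    apply: trank_min; have -> : a - s.-1 = a.+1 - s by lia.
    by have -> : b - s.-1 = b.+1 - s by lia.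
  move: h gt; case: extP => [c ec mc k0 l0||]; try lia.
  by move=> h1 h2; exists c; rewrite ec /=; lia.
have := tableau_ge c; rewrite e1 => ge.
have := valP c; rewrite (surjective_pairing (val c)) mem_young => /and3P[k0 l0 _].
have ec := ext_in c; move: (val c).1 (val c).2 ge e2 k0 l0 ec => k l ge e2 k0 l0 ec.
apply/eqP; rewrite eqn_leq; have /andP[-> _] := trank_d a b; rewrite andbT.
apply: (@leq_trans (a.+1 - k)).
  apply: trank_min; have -> : a.+1 - (a.+1 - k) = k by lia.
  by have -> : b.+1 - (a.+1 - k) = l; [lia | rewrite ec e1].
rewrite leqNgt; apply/negP => lt; have := trankP a b; set s := trank a b in lt *.
have := ext_diag k l (a - s - k).
have -> : k + (a - s - k) = a - s by lia.
by have -> : l + (a - s - k) = b - s; lia.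
Qed.

End Tableau.

(** * The bijection *)

Section Bijection.

Variables (n : nat) (v : 'S_n).
Hypothesis vex : vexillary v.

Local Notation w := (permn v).
Local Notation cell := (seq_sub (young (mu v))).

Lemma mu_sorted : sorted geq (mu v).
Proof. by apply: sort_sorted => a b; rewrite /=; lia. Qed.

Lemma flag_le k : flag v k <= n.
Proof.
rewrite /flag; elim/big_ind: _ => [|x y|j]; rewrite ?geq_max //; first by move=> -> ->.
by rewrite mem_young_lambda => /and3P[j0 _ /inner_lt[]]; lia.
Qed.

(** The position lies weakly north-west of the one that [flag v k] would give to the last cell of
    row [k], which is in [lambda v]. *)
Lemma flag_inner k l a : (k, l) \in young (mu v) -> k <= a -> a <= flag v k ->
  ~~ outer v a.-1 (a + l - k).-1.
Proof.
rewrite mem_young => /and3P[k0 l0 le_l] le_ka; apply: contraTN => out.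
rewrite -ltnNge /flag; elim/big_ind: _ => [|x y|j]; rewrite ?gtn_max //; first lia.
  by move=> -> ->.
rewrite mem_young_lambda => /and3P[j0 _]; rewrite ltnNge; apply: contra => le_aj.
by apply: outer_mono out; lia.
Qed.

Lemma flag_ge k a : 0 < k -> k <= a -> 0 < part (mu v) k ->
  ~~ outer v a.-1 (a + part (mu v) k - k).-1 -> a <= flag v k.
Proof.
move=> k0 le_ka mu0 inn; have [lt_an _] := inner_lt inn.
apply: (@leq_bigmax_seq _ _
  (fun j => (j, j + part (mu v) k - k) \in young (lambda v)) id a).
  by rewrite mem_index_iota; lia.
by rewrite mem_young_lambda inn; lia.
Qed.

Lemma cell_mem (c : cell) : ((val c).1, (val c).2) \in young (mu v).
Proof. by rewrite -surjective_pairing; exact: valP. Qed.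

Lemma cell_gt0 (c : cell) : (0 < (val c).1) && (0 < (val c).2).
Proof.
by have := cell_mem c; rewrite mem_young => /and3P[-> ->].
Qed.

(** * From a bumpless pipe dream to a flagged tableau *)

Section FromPipes.

Variable P : 'M[tile]_n.
Hypotheses (Pbpd : is_bpd P)
  (rk : forall i j, i <= n -> j <= n -> outer v i j -> rank P i j = prank v i j)
  (noX : forall i j, ~~ outer v i j -> rank P i.+1 j.+1 <= (rank P i j).+1).

Lemma blank_inner i j : i < n -> j < n -> tile_at P i j = Blank -> ~~ outer v i j.
Proof.
move=> lt_in lt_jn /eqP; rewrite blank_rank //; apply: contraTN => out.
have out' : outer v i.+1 j.+1 by apply: outer_mono out.
rewrite !rk ?(ltnW lt_in) ?(ltnW lt_jn) // prank_blank //.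
exact: outerP out _ _ lt_in lt_jn (leqnn i) (leqnn j).
Qed.

(** Inside [lambda v], row minus rank rises by one exactly at the blanks of the diagonal; the first
    [a] where it reaches [k] is the entry of the cell [(k, l)]. *)
Let entry_at k l a := k + rank P a (a + l - k) <= a.

Lemma entry_exists k l : (k, l) \in young (mu v) ->
  exists a, [/\ a <= n, a + l <= n + k & entry_at k l a].
Proof.
move=> mem; have := mem; rewrite mem_young => /and3P[k0 l0 _].
have /young_mu_rothe-/(_ vex)[i [j [lt_in lt_jn hb ek el]]] := mem.
have inn : ~~ outer v i j by apply/innerP; exists i, j; split.
have [d [le_i le_j d0 bd _]] := border_exists inn.
exists (i + d); split=> //; first by lia.
rewrite /entry_at; have -> : i + d + l - k = j + d by lia.
rewrite rk //; last by case/andP: bd.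
by rewrite -(border_young vex le_i le_j bd k0 l0) //; lia.
Qed.

Lemma entry_blank k l a : 0 < k -> 0 < l -> a <= n -> a + l <= n + k ->
  entry_at k l a -> (forall a', entry_at k l a' -> a <= a') ->
  exists i j, [/\ i < n, j < n, a = i.+1, a + l - k = j.+1 & tile_at P i j = Blank].
Proof.
move=> k0 l0 le_an le_aln ha mina; rewrite /entry_at in ha.
have le_ka : k <= a by lia.
have [j ej] : exists j, a + l - k = j.+1 by exists (a + l - k).-1; lia.
case: a => [|i] in le_an le_aln ha mina le_ka ej *; first by lia.
have lt_jn : j < n by lia.
exists i, j; split=> //; apply/eqP; rewrite blank_rank //.
rewrite ej in ha.
have mono : rank P i j <= rank P i.+1 j.+1.
  by rewrite (leq_trans (rank_le_S P i (leqnSn j))) // rank_leS.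
case: (ltnP i k) => [lt_ik|le_ki]; first by rewrite eqn_leq mono; lia.
have : ~~ entry_at k l i by apply/negP => /mina; lia.
by rewrite /entry_at; have -> : i + l - k = j; lia.
Qed.

(** The cell is [(i.+1 - r, j.+1 - r)]. By [noX], row minus rank never decreases inside the shape:
    forwards, this gives membership through [border_young]; backwards, it excludes earlier rows. *)
Lemma blank_entry i j : i < n -> j < n -> tile_at P i j = Blank ->
  exists k l, [/\ (k, l) \in young (mu v), i.+1 + l - k = j.+1,
     entry_at k l i.+1 & forall a, entry_at k l a -> i < a].
Proof.
move=> lt_in lt_jn e; have inn := blank_inner lt_in lt_jn e.
have := rank_le Pbpd (ltnW lt_in) (ltnW lt_jn).
move/eqP: e; rewrite blank_rank // => /eqP; set r := rank P i j => er le_r.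
exists (i.+1 - r), (j.+1 - r).
have [d [le_i le_j d0 bd innd]] := border_exists inn.
have ek : i.+1 + (j.+1 - r) - (i.+1 - r) = j.+1 by lia.
split=> //.
- rewrite (border_young vex le_i le_j bd); try lia.
  rewrite -rk //; last by case/andP: bd.
  have := @diag_le _ v (rank P) i.+1 j.+1 d.-1 noX.
  have -> : i.+1 + d.-1 = i + d by lia.
  have -> : j.+1 + d.-1 = j + d by lia.
  suff innd' e : e < d.-1 -> ~~ outer v (i.+1 + e) (j.+1 + e).
    by move=> /(_ innd'); lia.
  by move=> lt_e; have := innd e.+1; rewrite -!addSnnS; apply; lia.
- by rewrite /entry_at ek; lia.
move=> a; rewrite /entry_at ltnNge => ha; apply/negP => le_ai.
have := @diag_le _ v (rank P) a (a + (j.+1 - r) - (i.+1 - r)) (i - a) noX.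
have -> : a + (i - a) = i by lia.
have -> : a + (j.+1 - r) - (i.+1 - r) + (i - a) = j by lia.
rewrite -/r; suff innd' e : e < i - a ->
    ~~ outer v (a + e) (a + (j.+1 - r) - (i.+1 - r) + e).
  by move=> /(_ innd'); lia.
by move=> lt_e; apply: contra inn; apply: outer_mono; lia.
Qed.

Lemma tableau_of_pipes : exists T : FSYT v, coords (blanks P) =i positions (sval T).
Proof.
have ex (c : cell) : exists a, entry_at (val c).1 (val c).2 a.
  by have [a [_ _ h]] := entry_exists (cell_mem c); exists a.
pose T : tableau (mu v) := [ffun c => ex_minn (ex c)].
have TP (c : cell) : [/\ T c <= n, T c + (val c).2 <= n + (val c).1,
    entry_at (val c).1 (val c).2 (T c)
    & forall a, entry_at (val c).1 (val c).2 a -> T c <= a].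
  rewrite ffunE; case: ex_minnP => a ha mina; split=> //.
    by have [b [le_bn _ /mina]] := entry_exists (cell_mem c); lia.
  by have [b [_ le_bn /mina]] := entry_exists (cell_mem c); lia.
have T_ge (c : cell) : (val c).1 <= T c by case: (TP c) => _ _; rewrite /entry_at; lia.
have row (c d : cell) : (val c).1 = (val d).1 -> (val c).2 <= (val d).2 -> T c <= T d.
  move=> e1 e2; case: (TP c) => _ _ _; apply; case: (TP d) => _ _; rewrite /entry_at e1.
  move=> h _; apply: leq_trans h; rewrite leq_add2l rank_le_S //; lia.
have col (c d : cell) : (val c).2 = (val d).2 -> (val c).1 < (val d).1 -> T c < T d.
  move=> e1 e2; have ge := T_ge d; have := cell_gt0 c.
  case: (TP c) => _ _ _ minc; case: (TP d) => le1 le2; rewrite /entry_at => h _ c0.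
  (* Raising the corner of [d] by the row difference keeps its column and lands on the diagonal of
     [c], without increasing the rank. *)
  suff : T c <= T d - ((val d).1 - (val c).1) by lia.
  apply: minc; rewrite /entry_at.
  have -> : T d - ((val d).1 - (val c).1) + (val c).2 - (val c).1 =
            T d + (val d).2 - (val d).1 by lia.
  set b := T d + _ - _ in h *.
  have : rank P (T d - ((val d).1 - (val c).1)) b <= rank P (T d) b.
    by apply: rank_leS; lia.
  by lia.
have ss : semistandard T.
  apply/and3P; split; apply/forallP => c.
  - by apply: leq_trans (T_ge c); case/andP: (cell_gt0 c).
  - by apply/forallP => d; apply/implyP => /andP[/eqP]; exact: row.
  - by apply/forallP => d; apply/implyP => /andP[/eqP]; exact: col.
have blankT (c : cell) : exists i j, [/\ i < n, j < n, T c = i.+1,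
    T c + (val c).2 - (val c).1 = j.+1 & tile_at P i j = Blank].
  have /andP[k0 l0] := cell_gt0 c.
  by case: (TP c) => *; apply: entry_blank.
have fl : [forall c, T c <= flag v (val c).1].
  apply/forallP; move=> c; have /andP[k0 l0] := cell_gt0 c.
  have := cell_mem c; rewrite mem_young => /and3P[_ _ le_l].
  have mem' : ((val c).1, part (mu v) (val c).1) \in young (mu v).
    by rewrite mem_young k0 leqnn (leq_trans l0 le_l).
  (* The flag is defined by the last cell of a row, which carries the largest entry. *)
  pose d : cell := SeqSub mem'.
  apply: leq_trans (row c d _ _) _ => //=.
  have [i [j [lt_in lt_jn e1 e2 e3]]] := blankT d.
  apply: flag_ge => //; [exact: (T_ge d) | exact: leq_trans l0 le_l|].
  by rewrite e2 e1; apply: blank_inner.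
have Tok : semistandard T && [forall c, T c <= flag v (val c).1] by rewrite ss.
exists (exist _ T Tok) => -[x y] /=.
apply/mem_coords_blanks/imageP => [[i [j [lt_in lt_jn -> -> e]]]|[c _ [-> ->]]].
  have [k [l [mem ek h minh]]] := blank_entry lt_in lt_jn e.
  exists (SeqSub mem) => //.
  suff e1 : T (SeqSub mem) = i.+1 by rewrite e1 /= ek.
  have [_ _ h1 h2] := TP (SeqSub mem).
  by apply/eqP; rewrite eqn_leq (h2 _ h) (minh _ h1).
by have [i [j [lt_in lt_jn e1 e2 e3]]] := blankT c; exists i, j.
Qed.

End FromPipes.

(** * From a flagged tableau to a bumpless pipe dream *)

Section FromTableau.

Variable T : tableau (mu v).
Hypotheses (ssT : semistandard T) (flagT : forall c : cell, T c <= flag v (val c).1).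

Lemma flagged_le (c : cell) : T c <= n.
Proof. exact: leq_trans (flagT c) (flag_le _). Qed.

Local Notation tr := (trank T n).

Lemma flagged_inner (c : cell) : exists i j,
  [/\ T c = i.+1, T c + (val c).2 - (val c).1 = j.+1 & ~~ outer v i j].
Proof.
have ge := tableau_ge mu_sorted ssT flagged_le c.
have := flag_inner (cell_mem c) ge (flagT c); have := cell_gt0 c.
set x := T c in ge *; set y := x + _ - _ => c0 inn.
exists x.-1, y.-1; split=> //; lia.
Qed.

Lemma prank_le_minn a b : a <= n -> b <= n -> prank v a b <= minn a b.
Proof.
move=> le_an le_bn; rewrite leq_min prank_le /=.
by rewrite -[leqRHS](prankn v le_bn) prank_leS.
Qed.

(** By [border_young], the cells of [mu v] strictly above the border on this diagonal are those with
    [prank v a b <= s]. Flagging keeps their positions inside, so their entries are at most [a]; off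
    the shape the filling exceeds [n]. *)
Lemma trank_border a b : a <= n -> b <= n -> border v a b -> tr a b = prank v a b.
Proof.
move=> le_an le_bn bd.
have yng s : s < minn a b -> ((a - s, b - s) \in young (mu v)) = (prank v a b <= s).
  by move=> lt; rewrite (border_young vex le_an le_bn bd); lia.
have le := prank_le_minn le_an le_bn.
apply/eqP; rewrite eqn_leq; apply/andP; split.
  apply: trank_min; case: (ltnP (prank v a b) (minn a b)) => [lt|ge]; last first.
    have [->|->] : a - prank v a b = 0 \/ b - prank v a b = 0 by lia.
      by rewrite ext_0.
    by rewrite ext0.
  have := yng _ lt; rewrite leqnn; case: extP => [c ec _ k0 l0 _|//|/negbTE->//].
  have [i [j [e1 e2 inn]]] := flagged_inner c; rewrite ec /= in e2.
  rewrite leqNgt; apply/negP => lt_aT; case/negP: inn.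
  by case/andP: bd => out _; apply: outer_mono out; lia.
have := trankP T n a b; set s := tr a b => h.
case: (ltnP s (minn a b)) => [lt|]; last by apply: leq_trans.
rewrite -yng //; move: h; case: extP => //; lia.
Qed.

(** A unit step leaving the inner region ends on the border, where both formulas agree; each
    increment thus involves only one of them. *)
Definition mixed_rank (a b : nat) : nat := if outer v a b then prank v a b else tr a b.

Lemma mixed_rankE a b : a <= n -> b <= n ->
  [|| a == 0, b == 0 | ~~ outer v a.-1 b.-1] -> mixed_rank a b = tr a b.
Proof.
move=> le_an le_bn h; rewrite /mixed_rank; case: ifP => // out.
by rewrite trank_border // /border out.
Qed.

Lemma mixed_rank_h i j : i < n -> j <= n ->
  mixed_rank i j <= mixed_rank i.+1 j <= (mixed_rank i j).+1.
Proof.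
move=> lt_in le_jn; case: (boolP (outer v i j)) => [out|inn].
  have out' : outer v i.+1 j by apply: outer_mono out.
  by rewrite /mixed_rank out out' prankS; lia.
rewrite (@mixed_rankE i.+1) //; last first.
  by rewrite /= (contra _ inn) ?orbT //; apply: outer_mono => //; lia.
rewrite /mixed_rank (negbTE inn).
exact: trank_h mu_sorted ssT flagged_le _ _.
Qed.

Lemma mixed_rank_v i j : i <= n -> j < n ->
  mixed_rank i j <= mixed_rank i j.+1 <= (mixed_rank i j).+1.
Proof.
move=> le_in lt_jn; case: (boolP (outer v i j)) => [out|inn].
  have out' : outer v i j.+1 by apply: outer_mono out.
  by rewrite /mixed_rank out out' prank_S //; lia.
rewrite (@mixed_rankE i j.+1) //; last first.
  by rewrite /= (contra _ inn) ?orbT //; apply: outer_mono => //; lia.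
rewrite /mixed_rank (negbTE inn).
exact: trank_v mu_sorted ssT flagged_le _ _.
Qed.

Lemma pipes_of_tableau : exists P : Pipes v, coords (blanks (sval P)) =i positions T.
Proof.
have outn j : outer v n j by apply: contraT => /inner_lt; lia.
have out_n i : outer v i n by apply: contraT => /inner_lt; lia.
have [j lj|i li|j lj|i li|||P Pbpd rkP] := @rank_surj n mixed_rank.
- by rewrite mixed_rankE // trank0.
- by rewrite mixed_rankE ?orbT // trank_0.
- by rewrite /mixed_rank outn prankn.
- by rewrite /mixed_rank out_n prank_n.
- exact: mixed_rank_h.
- exact: mixed_rank_v.
have rk i j : i <= n -> j <= n -> outer v i j -> rank P i j = prank v i j.
  by move=> li lj out; rewrite rkP // /mixed_rank out.
have inn_rk i j : ~~ outer v i j ->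
    rank P i j = tr i j /\ rank P i.+1 j.+1 = tr i.+1 j.+1.
  move=> inn; have [li lj] := inner_lt inn.
  rewrite !rkP ?(ltnW li) ?(ltnW lj) // (@mixed_rankE i.+1 j.+1) //= ?inn //.
  by rewrite /mixed_rank (negbTE inn).
have noX i j : ~~ outer v i j -> tile_at P i j <> Crossing.
  move=> inn /eqP; have [li lj] := inner_lt inn; rewrite crossing_rank //.
  have [-> ->] := inn_rk i j inn.
  by have := trank_d mu_sorted ssT flagged_le i j; lia.
have ok : is_bpd P && [forall i, demazure P i == (v i).+1].
  rewrite Pbpd; apply/forallP => i; rewrite demazure_hlabel -permnE; apply/eqP.
  exact: (demazure_rank vex Pbpd rk noX).
exists (exist _ P ok) => -[x y] /=.
apply/mem_coords_blanks/imageP => [[i [j [li lj -> -> e]]]|[c _ [-> ->]]].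
  have inn := blank_inner Pbpd rk li lj e.
  move/eqP: e; rewrite blank_rank //; have [-> ->] := inn_rk i j inn => /eqP.
  move/(trank_blank mu_sorted ssT flagged_le); case=> // c [e1 e2].
  by exists c; rewrite ?e1 //= -?e1 e2.
have [i [j [e1 e2 inn]]] := flagged_inner c; have [li lj] := inner_lt inn.
exists i, j; split=> //; apply/eqP; rewrite blank_rank //.
have [-> ->] := inn_rk i j inn; apply/eqP.
by apply/(trank_blank mu_sorted ssT flagged_le) => //; exists c.
Qed.

End FromTableau.

(** The position of [S c] is that of some [T d] on the same diagonal. If [d] were in a higher row,
    then [S d = T d = S c] would contradict strict growth along the diagonal; so [d] is weakly
    below, and [T c <= T d]. *)
Lemma positions_le (S T : tableau (mu v)) (c : cell) :
  semistandard S -> semistandard T ->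
  (forall d : cell, S d <= n) -> (forall d : cell, T d <= n) ->
  positions S =i positions T ->
  (forall d : cell, (val d).1 < (val c).1 -> S d = T d) -> T c <= S c.
Proof.
move=> ssS ssT leS leT eqp IH.
have geS := tableau_ge mu_sorted ssS leS; have geT := tableau_ge mu_sorted ssT leT.
have : (S c, S c + (val c).2 - (val c).1) \in positions S by exact: image_f.
rewrite eqp => /imageP[d _ [e1 e2]].
have {geS} gS := geS c; have {geT} gT := geT d.
have /andP[c1 c2] := cell_gt0 c; have /andP[d1 d2] := cell_gt0 d.
have {}e2 : S c + (val c).2 - (val c).1 = T d + (val d).2 - (val d).1 by [].
have eqd : (val c).2 + (val d).1 = (val d).2 + (val c).1.
  by rewrite -e1 in gT e2; lia.
case: (ltnP (val d).1 (val c).1) => [lt|le].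
  have := ext_diag_lt mu_sorted ssS leS (val d).1 (d := (val c).1 - (val d).1) _ d2.
  have -> : (val d).1 + ((val c).1 - (val d).1) = (val c).1 by lia.
  have -> : (val d).2 + ((val c).1 - (val d).1) = (val c).2 by lia.
  by rewrite !ext_in (IH d lt) -e1 ltnn subn_gt0 => /(_ lt).
rewrite e1 -(ext_in T n c) -(ext_in T n d).
have := ext_diag mu_sorted ssT leT (val c).1 (val c).2 ((val d).1 - (val c).1).
have -> : (val c).1 + ((val d).1 - (val c).1) = (val d).1 by lia.
by have -> : (val c).2 + ((val d).1 - (val c).1) = (val d).2 by lia.
Qed.

Lemma positions_inj (T1 T2 : FSYT v) :
  positions (sval T1) =i positions (sval T2) -> T1 = T2.
Proof.
move=> eqp; have /andP[ss1 /forallP f1] := valP T1.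
have /andP[ss2 /forallP f2] := valP T2.
apply: val_inj; apply/ffunP => c.
suff eqT m (d : cell) : (val d).1 <= m -> sval T1 d = sval T2 d.
  exact: eqT (leqnn (val c).1).
elim: m d => [|m IHm] {}c le_c; first by have := cell_gt0 c; lia.
have IH (d : cell) : (val d).1 < (val c).1 -> sval T1 d = sval T2 d.
  by move=> lt; apply: IHm; lia.
apply/eqP; rewrite eqn_leq; apply/andP; split.
  apply: (positions_le ss2 ss1 (flagged_le f2) (flagged_le f1)) => // d /IH.
  by move=> ->.
exact: (positions_le ss1 ss2 (flagged_le f1) (flagged_le f2)).
Qed.

Lemma PipesP (P : Pipes v) : [/\ is_bpd (sval P),
  forall i j, i <= n -> j <= n -> outer v i j -> rank (sval P) i j = prank v i j
  & forall i j, ~~ outer v i j -> rank (sval P) i.+1 j.+1 <= (rank (sval P) i j).+1].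
Proof.
case: P => P /= /andP[Pbpd /forallP dem].
have dem' i : i < n -> hlabel P i n = (w i).+1.
  move=> li; rewrite (permnE v (Ordinal li)) -(eqP (dem (Ordinal li))).
  by rewrite demazure_hlabel.
split=> // [|i j inn]; first exact: rank_outer.
have [li lj] := inner_lt inn.
have /eqP := inner_no_crossing vex Pbpd dem' inn; rewrite crossing_rank //.
by rewrite rank_S rankS ?(ltnW lj) //; lia.
Qed.

(** Outer ranks are fixed by [v]; elsewhere the diagonal increment is 0 or 1 according to whether
    the cell is blank, so ranks propagate from the north-west. *)
Lemma blanks_inj (P Q : Pipes v) :
  coords (blanks (sval P)) =i coords (blanks (sval Q)) -> P = Q.
Proof.
case: (PipesP P) (PipesP Q) => [bP rP dP] [bQ rQ dQ] eqb.
suff : sval P = sval Q by exact: val_inj.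
have eqt i j : i < n -> j < n ->
    (tile_at (sval P) i j == Blank) = (tile_at (sval Q) i j == Blank).
  move=> li lj; have := eqb (i.+1, j.+1).
  have mem (R : 'M[tile]_n) : ((i.+1, j.+1) \in coords (blanks R)) = (tile_at R i j == Blank).
    apply/mem_coords_blanks/eqP => [[a [b [_ _ [->] [->]]]] //|e].
    by exists i, j.
  by rewrite !mem.
apply: rank_inj => // i j li lj.
elim: i j li lj => [|i IHi] j li lj; first by rewrite !rank0.
case: j lj => [|j] lj; first by rewrite !rank_0.
case: (boolP (outer v i.+1 j.+1)) => [out|inn]; first by rewrite rP // rQ.
have inn' : ~~ outer v i j by apply: contra inn; apply: outer_mono.
have mono (R : 'M[tile]_n) : is_bpd R -> rank R i j <= rank R i.+1 j.+1.
  move=> bR; apply: leq_trans (rank_le_S R i (leqnSn j)) _.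
  exact: rank_leS.
have := eqt i j li lj; rewrite !blank_rank //.
have := dP i j inn'; have := dQ i j inn'; have := mono _ bP; have := mono _ bQ.
by have := IHi j (ltnW li) (ltnW lj); lia.
Qed.

End Bijection.

Theorem theorem7p7 (n : nat) (v : 'S_n) (vex : vexillary v) :
  exists gamma : FSYT v -> Pipes v,
    (forall T : FSYT v,
       unique (fun P : Pipes v => coords (blanks (sval P)) =i positions (sval T))
              (gamma T))
    /\ bijective gamma.
Proof.
(* A boolean form of the relation, so that [xchoose] can select witnesses in both directions. *)
pose good (T : FSYT v) (P : Pipes v) :=
  all (mem (positions (sval T))) (coords (blanks (sval P))) &&
  all (mem (coords (blanks (sval P)))) (positions (sval T)).
have goodP T P : reflect (coords (blanks (sval P)) =i positions (sval T)) (good T P).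
  apply: (iffP andP) => [[/allP h1 /allP h2] x|h].
    by apply/idP/idP => [/h1|/h2].
  by split; apply/allP => x; rewrite inE h.
have exP T : exists P, good T P.
  case: T => T ok; have /andP[ss /forallP fl] := ok.
  by have [P h] := pipes_of_tableau vex ss fl; exists P; apply/goodP.
have exT P : exists T, good T P.
  case: (PipesP vex P) => b r d.
  by have [T h] := tableau_of_pipes vex b r d; exists T; apply/goodP.
exists (fun T => xchoose (exP T)); split=> [T|].
  have /goodP h := xchooseP (exP T); split=> // Q hQ.
  by apply: (blanks_inj vex) => x; rewrite h hQ.
exists (fun P => xchoose (exT P)) => [T|P].
  have /goodP h := xchooseP (exP T); have /goodP h' := xchooseP (exT (xchoose (exP T))).
  by apply: positions_inj => x; rewrite -h' h.
have /goodP h := xchooseP (exT P); have /goodP h' := xchooseP (exP (xchoose (exT P))).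
by apply: (blanks_inj vex) => x; rewrite h' h.
Qed.
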